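(* For every constant $C_1\ge2$ there exist constants $c,C>0$ depending only on $C_1$ such that, in the rotation group synchronization model with parameters $(n,d,p,\sigma)$, if $\frac{np}{\sigma^2}\ge c$ and $2\le d\le C_1$, then $$\inf_{\widehat Z\in\mathcal{SO}(d)^n}\ \sup_{Z\in\mathcal{SO}(d)^n}\mathbb E_Z\,\bar\ell(\widehat Z,Z)\ \ge\ \left(1-C\left(\frac1n+\frac{\sigma^2}{np}\right)\right)\frac{\sigma^2d(d-1)}{2np}.$$
   Context: Here $n\ge2$, $d$ are integers, $p\in(0,1]$, $\sigma>0$. $\mathcal{SO}(d)=\{U\in\mathbb R^{d\times d}:UU^T=U^TU=I_d,\ \det(U)=1\}$; $\|\cdot\|_F$ is the Frobenius norm. Model: for a parameter $Z=(Z_1,\dots,Z_n)\in\mathcal{SO}(d)^n$, let $Y_{ij}=Z_iZ_j^{T}+\sigma W_{ij}\in\mathbb R^{d\times d}$ for $1\le i<j\le n$, where the $W_{ij}$ are independent $d\times d$ matrices with i.i.d. $N(0,1)$ entries. Independently of the $W_{ij}$, let $A_{ij}\sim\mathrm{Bernoulli}(p)$ be independent for $1\le i<j\le n$. One observes $\{A_{ij}\}$ and those $Y_{ij}$ with $A_{ij}=1$. $\mathbb E_Z$ denotes expectation when the true parameter is $Z$; the infimum is over all estimators, i.e. measurable $\mathcal{SO}(d)^n$-valued functions of the observed data. Loss: $\bar\ell(\widehat Z,Z)=\min_{B\in\mathcal{SO}(d)}\frac1n\sum_{i=1}^n\|\widehat Z_i-Z_iB\|_F^2$. *)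

(* Defs.v *)
From HB Require Import structures.
From mathcomp Require Import all_boot all_order all_algebra.
From mathcomp Require Import all_classical all_reals all_analysis.

Set Implicit Arguments.
Unset Strict Implicit.
Unset Printing Implicit Defensive.

Import Order.TTheory GRing.Theory Num.Theory.
Import numFieldNormedType.Exports.

Local Open Scope classical_set_scope.
Local Open Scope ring_scope.

Section rotations.
Context (R : realType).

Definition SO (d : nat) : set 'M[R]_d :=
  [set U | [/\ U *m U^T = 1%:M, U^T *m U = 1%:M & \det U = 1]].

Definition SOn (n d : nat) : set ('I_n -> 'M[R]_d) :=
  [set Z | forall i, SO (Z i)].

(* The library norm on matrices is the sup norm. *)
Definition frob (d : nat) (M : 'M[R]_d) : R :=
  Num.sqrt (\sum_(k < d) \sum_(l < d) M k l ^+ 2).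

Definition aligned_loss (n d : nat) (Zh Z : 'I_n -> 'M[R]_d) (B : 'M[R]_d) : R :=
  n%:R^-1 * \sum_(i < n) frob (Zh i - Z i *m B) ^+ 2.

(* [inf] is a minimum here, see [loss_min]. *)
Definition loss (n d : nat) (Zh Z : 'I_n -> 'M[R]_d) : R :=
  inf [set aligned_loss Zh Z B | B in @SO d].

End rotations.

Lemma SO1 (R : realType) (d : nat) : @SO R d 1%:M.
Proof. by split; rewrite ?trmx1 ?mulmx1 ?det1. Qed.

Section continuity.
Variables (R : realType) (T : topologicalType).
Lemma continuous_sumf (I : Type) (r : seq I) (F : I -> T -> R) :
  (forall i, continuous (F i)) -> continuous (fun v => \sum_(i <- r) F i v).
Proof.
move=> h x; elim: r => [|i r IH].
  by under eq_fun do rewrite big_nil; exact: cvg_cst.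
under eq_fun do rewrite big_cons.
exact: (cvgD (h i x) IH).
Qed.
Lemma continuous_prodf (I : Type) (r : seq I) (F : I -> T -> R) :
  (forall i, continuous (F i)) -> continuous (fun v => \prod_(i <- r) F i v).
Proof.
move=> h x; elim: r => [|i r IH].
  by under eq_fun do rewrite big_nil; exact: cvg_cst.
under eq_fun do rewrite big_cons.
exact: (cvgM (h i x) IH).
Qed.
Lemma closed_fiber (f : T -> R) (c : R) : continuous f -> closed [set v | f v = c].
Proof. move=> h; exact: (preimage_closed (fun x _ => h x) (@closed_eq R c)). Qed.
Lemma continuous_scalef (c : R) (f : T -> R) : continuous f -> continuous (fun v => c * f v).
Proof. by move=> h x; apply: cvgM; [exact: cvg_cst|exact: h]. Qed.
Lemma continuous_sqrBf (c : R) (f : T -> R) : continuous f -> continuous (fun v => (c - f v) ^+ 2).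
Proof.
move=> h x; have h' : (fun v => c - f v) @ x --> c - f x.
  by apply: cvgB; [exact: cvg_cst|exact: h].
exact: (cvgM h' h').
Qed.
End continuity.

Lemma loss_min (R : realType) (n d : nat) (Zh Z : 'I_n -> 'M[R]_d) :
  exists2 B, SO B & loss Zh Z = aligned_loss Zh Z B /\
    forall B', SO B' -> aligned_loss Zh Z B <= aligned_loss Zh Z B'.
Proof.
pose D : set 'rV[R]_(d * d) := [set v | SO (vec_mx v)].
have ce k l : continuous (fun v : 'rV[R]_(d * d) => vec_mx v k l : R).
  under [X in continuous X]eq_fun do rewrite mxE.
  exact: coord_continuous.
have cD : compact D.
  have -> : D = [set v : 'rV[R]_(d * d) | forall i, `[-1, 1]%classic (v ord0 i)] `&` D.
    apply/seteqP; split => [v Dv|v []//]; split => // i /=.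
    case: Dv => h _ _; case/mxvec_indexP: i => k l.
    have /(congr1 (fun M : 'M[R]_d => M k k)) := h.
    rewrite !mxE eqxx => hk.
    have : (vec_mx v k l) ^+ 2 <= 1.
      rewrite -[leRHS]hk (bigD1 l)//= !mxE -expr2 lerDl.
      by apply: sumr_ge0 => j _; rewrite !mxE -expr2 sqr_ge0.
    by rewrite mxE -(real_normK (num_real _)) expr_le1 ?normr_ge0 ?in_itv/= ?ler_norml.
  apply: compact_closedI.
    apply: (@rV_compact R (d * d) (fun=> `[-1, 1]%classic)) => i.
    exact: segment_compact.
  have -> : D =
     (\bigcap_(x : 'I_d * 'I_d) [set v | (vec_mx v *m (vec_mx v)^T) x.1 x.2 = 1%:M x.1 x.2]) `&`
     (\bigcap_(x : 'I_d * 'I_d) [set v | ((vec_mx v)^T *m vec_mx v) x.1 x.2 = 1%:M x.1 x.2]) `&`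
     [set v | \det (vec_mx v) = 1].
    apply/seteqP; split => v.
      by case=> h1 h2 h3; (split => //; split) => x _ /=; rewrite ?h1 ?h2.
    case=> [[h1 h2] h3]; split => //; apply/matrixP => i j.
      exact: (h1 (i, j)).
    exact: (h2 (i, j)).
  apply: closedI; first (apply: closedI; apply: closed_bigI => x _; apply: closed_fiber).
  - rewrite [X in continuous X](_ : _ = fun v : 'rV[R]_(d * d) =>
        \sum_j vec_mx v x.1 j * vec_mx v x.2 j); last first.
      by apply/funext => v; rewrite mxE; apply: eq_bigr => j _; rewrite [_^T _ _]mxE.
    by apply: continuous_sumf => j v; exact: (cvgM (ce _ _ v) (ce _ _ v)).
  - rewrite [X in continuous X](_ : _ = fun v : 'rV[R]_(d * d) =>
        \sum_j vec_mx v j x.1 * vec_mx v j x.2); last first.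
      by apply/funext => v; rewrite mxE; apply: eq_bigr => j _; rewrite [_^T _ _]mxE.
    by apply: continuous_sumf => j v; exact: (cvgM (ce _ _ v) (ce _ _ v)).
  - apply: closed_fiber; rewrite /determinant.
    apply: continuous_sumf => s; apply: continuous_scalef.
    by apply: continuous_prodf => i; exact: ce.
have cf : continuous (fun v : 'rV[R]_(d * d) => aligned_loss Zh Z (vec_mx v)).
  apply: continuous_scalef; apply: continuous_sumf => i v; rewrite /frob.
  have fE (w : 'rV[R]_(d * d)) : Num.sqrt (\sum_(k < d) \sum_(l < d) (Zh i - Z i *m vec_mx w) k l ^+ 2) ^+ 2 =
     \sum_(k < d) \sum_(l < d) (Zh i k l - \sum_j Z i k j * vec_mx w j l) ^+ 2.
    rewrite sqr_sqrtr; last by do 2 (apply: sumr_ge0 => ? _); exact: sqr_ge0.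
    by apply: eq_bigr => k _; apply: eq_bigr => l _; rewrite !mxE.
  under eq_fun do rewrite fE.
  apply: continuous_sumf => k {}v; apply: continuous_sumf => l; apply: continuous_sqrBf.
  by apply: continuous_sumf => j; apply: continuous_scalef; exact: ce.
have D0 : D !=set0 by exists (mxvec 1%:M); rewrite /D /= mxvecK; exact: SO1.
have [v /set_mem Dv vmin] := compact_EVT_min D0 cD (continuous_subspaceT cf).
have min B' : SO B' -> aligned_loss Zh Z (vec_mx v) <= aligned_loss Zh Z B'.
  by move=> hB; rewrite -[B']mxvecK; apply: vmin; apply/mem_set; rewrite /D /= mxvecK.
exists (vec_mx v) => //; split => //; apply/eqP; rewrite eq_le; apply/andP; split.
  apply: ge_inf; last by exists (vec_mx v).
  by exists (aligned_loss Zh Z (vec_mx v)) => _ [B hB <-]; exact: min.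
apply: lb_le_inf; first by exists (aligned_loss Zh Z (vec_mx v)), (vec_mx v).
by move=> _ [B hB <-]; exact: min.
Qed.

Definition edge (n : nat) := {e : 'I_n * 'I_n | (e.1 < e.2)%N}.

Section independence.
Context (disp : measure_display) (Omega : measurableType disp) (R : realType).

Definition mutually_independent (P : probability Omega R) (I : finType)
    (F : I -> set (set Omega)) : Prop :=
  forall (J : {set I}) (E : I -> set Omega),
    (forall i, i \in J -> F i (E i)) ->
    P (\bigcap_(i in [set` J]) E i) = (\prod_(i in J) P (E i))%E.

End independence.

Section data.
Context (R : realType) (n d : nat).

(* [None] at [e] means that the pair [e] is not observed (A_e = 0). *)
Definition data := edge n -> option 'M[R]_d.

Definition observed (e : edge n) (y : data) : bool := isSome (y e).

Definition entry (e : edge n) (k l : 'I_d) (y : data) : R :=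
  if y e is Some M then M k l else 0.

(* Generators of the coordinate sigma-algebra, i.e. of the product over the
   pairs of the Borel sigma-algebra of {None} + R^(d x d). *)
Definition data_cylinders : set (set data) :=
  (\bigcup_e preimage_set_system setT (observed e) measurable) `|`
  (\bigcup_(x : edge n * ('I_d * 'I_d))
     preimage_set_system setT (entry x.1 x.2.1 x.2.2) measurable).

Definition estimator (Zh : data -> 'I_n -> 'M[R]_d) : Prop :=
  (forall y, SOn (Zh y)) /\
  forall i k l, measurable_fun setT
    (fun y : g_sigma_algebraType data_cylinders => Zh y i k l : R).

End data.

Section model.
Context (R : realType) (n d : nat) (disp : measure_display)
  (Omega : measurableType disp) (P : probability Omega R).
Variables (A : edge n -> {RV P >-> bool})
  (W : edge n -> 'I_d -> 'I_d -> {RV P >-> R}).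

Definition coordinate_sigma_algebra (x : edge n + edge n * ('I_d * 'I_d)) :
    set (set Omega) :=
  match x with
  | inl e => g_sigma_algebra_preimage (A e)
  | inr (e, (k, l)) => g_sigma_algebra_preimage (W e k l)
  end.

(* [normal_prob 0 1] is also defined, without meaning, off the Borel sets,
   hence the guard on [B]. *)
Definition sync_noise (p : R) : Prop :=
  [/\ forall e B, measurable B -> distribution P (A e) B = bernoulli_prob p B,
      forall e k l B, measurable B ->
        distribution P (W e k l) B = normal_prob 0 1 B
    & mutually_independent P coordinate_sigma_algebra].

Definition measurement (sigma : R) (Z : 'I_n -> 'M[R]_d) (e : edge n)
    (w : Omega) : 'M[R]_d :=
  Z (val e).1 *m (Z (val e).2)^T + sigma *: \matrix_(k, l) W e k l w.

Definition observation (sigma : R) (Z : 'I_n -> 'M[R]_d) (w : Omega) :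
    data R n d :=
  fun e => if A e w then Some (measurement sigma Z e w) else None.

Definition risk (sigma : R) (Zh : data R n d -> 'I_n -> 'M[R]_d)
    (Z : 'I_n -> 'M[R]_d) : \bar R :=
  ('E_P[fun w => loss (Zh (observation sigma Z w)) Z])%E.

Definition minimax_risk (sigma : R) : \bar R :=
  ereal_inf [set ereal_sup [set risk sigma Zh Z | Z in @SOn R n d]
            | Zh in @estimator R n d].

End model.

(* Main.v *)
(* A Bayesian lower bound of van Trees type, with a prior that carries no
   information of its own.

   Minimising over all matrices instead of rotations only decreases the loss, and
   gives [loss >= r := d - |S|^2] with [S := n^-1 sum_j Zh_j^T Z_j].  For
   [N_i := Zh_i S Z_i^T] one has [n^-1 sum_i |1 - N_i|^2 = r] and
   [n^-1 sum_i tr N_i = d - r].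

   Under the Haar prior, rotating [Z_i] in the plane [(k, l)] changes nothing on
   average.  It acts on the data as a shift of the Gaussian noise, so the change of
   the expectation of [N_kl - N_lk] is controlled by the chi-square divergence of
   that shift; letting the angle tend to 0,
   [2 E(N_kk + N_ll - 2/n) <= eta E(N_kl - N_lk)^2 + 2], [eta := n p / sigma^2].
   Summing over [i] and [k < l] gives [(eta + d - 1) E r >= d (d - 1) / 2 (1 - 2/n)].

   The prior is obtained by orthonormalising square Gaussian matrices, taken from
   the noise of an independent copy of the probability space; only those whose
   orthonormalisation is a rotation are kept, which has positive probability.
   Shifts and rotations of Gaussian coordinates both come from the shear
   [x -> x + c], where [c] may depend on the other coordinates. *)
From HB Require Import structures.
From mathcomp Require Import all_boot all_order all_algebra.
From mathcomp Require Import all_classical all_reals all_analysis.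
From mathcomp Require Import ring lra.
Require Import Defs.
Import Order.TTheory GRing.Theory Num.Theory.
Import numFieldNormedType.Exports.
From mathcomp Require Import measurable_realfun.
Set Implicit Arguments.
Unset Strict Implicit.
Unset Printing Implicit Defensive.
Local Open Scope classical_set_scope.
Local Open Scope ring_scope.

(** * Gaussian shifts of the line *)

(** A classical van Trees argument differentiates in the parameter, but here [Zh] is only measurable
    and the loss ignores a global rotation. Two choices answer this. The matrices [N_i] do not
    change when every [Z_j] is multiplied on the right by one common rotation, so they test only
    what the loss sees. And all comparisons are made at a finite angle, with an explicit remainder
    that is removed at the end.

    The summand [2/n] arises because [Z_i] also enters [S], with weight [n^-1]; it is the source of
    the [1/n] in the theorem. The [d - 1] beside [eta] comes from the deficit on the diagonals of
    the [N_i], and produces the term [sigma^2/(n p)].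

    The probability space is arbitrary and offers only the noise of [n (n-1) / 2] pairs. A prior for
    [n] matrices drawn from one copy needs [n] distinct pairs, which exist for [n >= 3]; at [n = 2]
    the factor [1 - 2/n] vanishes. Of Haar measure only the invariance under left rotation of a
    single [Z_i] is used. *)

Section density.
Context d (T : measurableType d) (R : realType).
Local Open Scope ereal_scope.
Import HBNNSimple.

(** The hypothesis on [nu A] is the case of indicators; it extends to nonnegative simple functions
    by linearity, and to [f] by monotone convergence along [nnsfun_approx]. *)
Lemma ge0_integral_density (mu nu : {measure set T -> \bar R}) (h : T -> R)
    (f : T -> \bar R) :
  measurable_fun setT h -> (forall x, (0 <= h x)%R) ->
  (forall A, measurable A -> nu A = \int[mu]_(x in A) (h x)%:E) ->
  measurable_fun setT f -> (forall x, 0 <= f x) ->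
  \int[nu]_x f x = \int[mu]_x (f x * (h x)%:E).
Proof.
move=> mh h0' nuE mf f0; pose f_ := nnsfun_approx measurableT mf.
have mEh : measurable_fun setT (EFin \o h) by exact/measurable_EFinP.
have h0 x : 0 <= (h x)%:E by rewrite lee_fin.
transitivity (limn (fun n => \int[nu]_x (f_ n x)%:E)).
  rewrite -monotone_convergence//.
  - by apply: eq_integral => y _; apply/esym/cvg_lim => //; exact: cvg_nnsfun_approx.
  - by move=> n; exact/measurable_EFinP/measurable_funP.
  - by move=> n y _; rewrite lee_fin.
  - by move=> y _ a b ab; rewrite lee_fin; exact/lefP/nd_nnsfun_approx.
rewrite [X in limn X](_ : _ =
    (fun n => \int[mu]_x ((f_ n x)%:E * (h x)%:E))); last first.
  apply/funext => n.
  under eq_integral do rewrite fimfunE// -fsumEFin//.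
  rewrite ge0_integral_fsum//; first last.
    by move=> r y _; rewrite lee_fin; exact: nnfun_muleindic_ge0.
    by move=> r; exact/measurable_EFinP/measurableT_comp.
  under [RHS]eq_integral.
    move=> x _; rewrite fimfunE -fsumEFin// ge0_mule_fsuml; last first.
      by move=> r; rewrite lee_fin; exact: nnfun_muleindic_ge0.
    over.
  rewrite ge0_integral_fsum//; first last.
    - move=> r y _; apply: mule_ge0 => //; rewrite lee_fin; exact: nnfun_muleindic_ge0.
    - move=> r; apply: emeasurable_funM => //.
      by apply/measurable_EFinP/measurableT_comp => //.
  apply: eq_fsbigr => r rf.
  rewrite integralZl_indic_nnsfun// integral_indic//= setIT nuE//.
  under [RHS]eq_integral do rewrite EFinM -muleA.
  rewrite ge0_integralZl//=; first last.
  - by move: rf; rewrite inE => -[t _ <-]; rewrite lee_fin.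
  - by move=> x _; apply: mule_ge0 => //; rewrite lee_fin.
  - by apply: emeasurable_funM => //; apply/measurable_EFinP; exact: measurable_indic.
  congr (_ * _); rewrite integral_mkcond; apply: eq_integral => x _.
  by rewrite epatch_indic/= muleC.
rewrite -monotone_convergence//.
- apply: eq_integral => y _; apply/cvg_lim => //.
  apply: cvgeZr => //; exact: cvg_nnsfun_approx.
- by move=> n; apply: emeasurable_funM => //; exact/measurable_EFinP/measurable_funP.
- by move=> n y _; rewrite -EFinM lee_fin; apply: mulr_ge0.
- by move=> y _ a b ab; apply: lee_wpmul2r => //; rewrite lee_fin; exact/lefP/nd_nnsfun_approx.
Qed.

End density.

Section image_measure.
Context d1 d2 (T1 : measurableType d1) (T2 : measurableType d2) (R : realType).
Variables (m : {measure set T1 -> \bar R}) (f : T1 -> T2).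
Hypothesis mf : measurable_fun setT f.

(** The pushforward packaged with its measure structure, so that uniqueness of measures and change
    of variables apply to it. *)
Definition image_measure : {measure set T2 -> \bar R} :=
  measure_function_pushforward__canonical__measure_function_Measure m mf.

Lemma ge0_integral_image_measure (g : T2 -> \bar R) :
  measurable_fun setT g -> (forall y, 0 <= g y)%E ->
  (\int[image_measure]_y g y = \int[m]_x g (f x))%E.
Proof. by move=> mg g0; rewrite ge0_integral_pushforward. Qed.

End image_measure.

Section normal_shift.
Context (R : realType).
Local Notation lambda := (@lebesgue_measure R).
Local Open Scope ereal_scope.

Lemma ge0_integral_normal_prob (m s : R) (f : R -> \bar R) :
  measurable_fun setT f -> (forall x, 0 <= f x) ->
  \int[normal_prob m s]_x f x = \int[lambda]_x (f x * (normal_pdf m s x)%:E).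
Proof.
move=> mf f0.
apply: (@ge0_integral_density _ (measurableTypeR R) R lambda (normal_prob m s)) => //.
- exact: measurable_normal_pdf.
- by move=> x; exact: normal_pdf_ge0.
Qed.

Let shift_measurable (c : R) : measurable_fun [set: measurableTypeR R]
  (fun x : measurableTypeR R => (x + c)%R : measurableTypeR R).
Proof. exact: measurable_funD. Qed.

Lemma lebesgue_measure_shift (c : R) (A : set R) : measurable A ->
  image_measure lambda (shift_measurable c) A = lambda A.
Proof.
move=> mA; apply/esym; apply: lebesgue_measure_unique => //= _ [[a b]] _ <-.
rewrite /pushforward.
have -> : (+%R^~ c) @^-1` [set` `]a, b]] = `](a - c)%R, (b - c)%R]%classic.
  by apply/seteqP; split => x /=; rewrite !in_itv/= ltrBlDr lerBrDr.
rewrite !lebesgue_measure_itv/= !lte_fin ltrD2r.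
by case: ifP => // _; congr (_%:E); ring.
Qed.

Lemma ge0_integral_shift (c : R) (f : R -> \bar R) :
  measurable_fun setT f -> (forall x, 0 <= f x) ->
  \int[lambda]_x f (x + c)%R = \int[lambda]_x f x.
Proof.
move=> mf f0; rewrite -(ge0_integral_image_measure lambda (shift_measurable c))//.
by apply: eq_measure_integral => A mA _; exact: lebesgue_measure_shift.
Qed.

(** The one-dimensional Cameron-Martin formula: after translating Lebesgue measure, the exponential
    is the ratio of the two Gaussian densities. *)
Lemma normal_prob_shift (c : R) (f : R -> \bar R) :
  measurable_fun setT f -> (forall x, 0 <= f x) ->
  \int[normal_prob 0 1]_x f (x + c)%R =
  \int[normal_prob 0 1]_x (f x * (expR (c * x - c ^+ 2 / 2))%:E).
Proof.
move=> mf f0.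
have mfc : measurable_fun setT (fun x : R => f (x + c)%R).
  by apply: measurableT_comp => //; exact: measurable_funD.
have mg : measurable_fun setT (fun x : R => f x * (expR (c * x - c ^+ 2 / 2))%:E).
  apply: emeasurable_funM => //; apply/measurable_EFinP; apply: measurableT_comp => //.
  by apply: measurable_funB => //; exact: measurable_funM.
have g0 x : 0 <= f x * (expR (c * x - c ^+ 2 / 2))%:E.
  by apply: mule_ge0 => //; rewrite lee_fin expR_ge0.
rewrite (ge0_integral_normal_prob _ _ mfc)// (ge0_integral_normal_prob _ _ mg)//.
pose h x := f x * (expR (c * x - c ^+ 2 / 2))%:E * (normal_pdf 0 1 x)%:E.
have mh : measurable_fun setT h.
  by apply: emeasurable_funM => //; apply/measurable_EFinP; exact: measurable_normal_pdf.
have h0 x : 0 <= h x by apply: mule_ge0 => //; rewrite lee_fin normal_pdf_ge0.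
rewrite -[RHS](ge0_integral_shift c mh h0).
apply: eq_integral => x _; rewrite /h -muleA -EFinM; congr (_ * _%:E).
rewrite normal_pdfE ?oner_neq0// mulrCA /normal_fun -expRD; congr (_ * expR _)%R.
by field.
Qed.

End normal_shift.

(** * Independent coordinates *)

Section coordinate_space.
Context (R : realType) (J : finType).

Definition rectangle (B : J -> set R) : set (J -> R) :=
  [set z | forall j, B j (z j)].

(** A finite product of lines is encoded by functions on [J] rather than nested pairs, so that any
    coordinate can be singled out without reordering. *)
Definition rectangles : set (set (J -> R)) :=
  [set rectangle B | B in [set B | forall j, measurable (B j)]].

Local Notation coords := (g_sigma_algebraType rectangles).

Definition coord (j : J) (z : coords) : R := z j.

Lemma measurable_rectangle (B : J -> set R) :
  (forall j, measurable (B j)) -> measurable (rectangle B : set coords).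
Proof. by move=> mB; apply: sub_sigma_algebra; exists B. Qed.

Lemma measurable_coord (j : J) : measurable_fun setT (coord j).
Proof.
move=> _ B mB; rewrite setTI.
have -> : coord j @^-1` B = rectangle (fun k => if k == j then B else setT).
  apply/seteqP; split => z /=; last by move=> /(_ j); rewrite eqxx.
  by move=> zj k; case: eqP => [->|].
by apply: measurable_rectangle => k; case: ifP.
Qed.

Lemma measurable_coords d (S : measurableType d) (f : S -> coords) :
  (forall j, measurable_fun setT (fun x => f x j)) -> measurable_fun setT f.
Proof.
move=> mf; apply: (@measurability _ _ S coords setT f rectangles) => //.
move=> _ [_ [B mB <-] <-]; rewrite setTI.
have -> : f @^-1` rectangle B = \bigcap_(j in [set: J]) ((fun x => f x j) @^-1` B j).
  by apply/seteqP; split => x /= h; [move=> j _; exact: h|move=> j; exact: h].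
apply: fin_bigcap_measurable => //.
by move=> j _; rewrite -[X in measurable X]setTI; apply: mf.
Qed.

Lemma setI_closed_rectangles : setI_closed rectangles.
Proof.
move=> _ _ [B mB <-] [C mC <-]; exists (fun j => B j `&` C j).
  by move=> j; apply: measurableI.
by apply/seteqP; split => z /=; [move=> h; split => j; case: (h j)|case=> h1 h2 j].
Qed.

(** Rectangles form a pi-system that contains the whole space, so they determine a finite
    measure. *)
Lemma eq_measure_coords (m1 m2 : {measure set coords -> \bar R}) :
  (m1 setT < +oo)%E ->
  (forall B : J -> set R, (forall j, measurable (B j)) ->
     m1 (rectangle B) = m2 (rectangle B)) ->
  forall A, measurable A -> m1 A = m2 A.
Proof.
move=> m1T m12 A mA.
have rT : rectangle (fun=> setT) = setT by apply/seteqP; split.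
apply: (@measure_unique _ R coords rectangles (fun=> setT)) => //.
- exact: setI_closed_rectangles.
- by move=> _; exists (fun=> setT).
- by rewrite bigcup_const //; exists 0%N.
- by move=> _ [B mB <-]; exact: m12.
Qed.

Definition update (z : coords) (x : J) (s : R) : coords :=
  fun j => if j == x then s else z j.

Lemma measurable_update (x : J) :
  measurable_fun setT (fun p : measurableTypeR R * coords => update p.2 x p.1).
Proof.
apply: measurable_coords => j; rewrite /update.
case: (j == x); first exact: measurable_fst.
exact: (measurableT_comp (measurable_coord j) measurable_snd).
Qed.

Lemma update_update z x s t : update (update z x s) x t = update z x t.
Proof. by apply/funext => j; rewrite /update; case: eqP. Qed.

Lemma updateE z x s : update z x s x = s.
Proof. by rewrite /update eqxx. Qed.

End coordinate_space.
Notation coords R J := (g_sigma_algebraType (@rectangles R J)).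

Section resampling.
Context (R : realType) (J : finType) (mu : probability (coords R J) R).

Definition independent_coords : Prop :=
  forall B : J -> set R, (forall j, measurable (B j)) ->
    mu (rectangle B) = (\prod_j mu (coord j @^-1` B j))%E.

Definition coord_law (x : J) (nu : {measure set (measurableTypeR R) -> \bar R}) : Prop :=
  forall B, measurable B -> mu (coord x @^-1` B) = nu B.

Definition gaussian_coord (x : J) : Prop := coord_law x (normal_prob 0 1).

Hypothesis imu : independent_coords.
Local Open Scope ereal_scope.

(** Independence lets coordinate [x] be replaced by a fresh independent draw. The two laws are
    compared on rectangles: the fresh draw carries the side [B x], and the old coordinate is left
    free. *)
Lemma resample (x : J) (N : probability (measurableTypeR R) R)
    (h : coords R J -> \bar R) : coord_law x N ->
  measurable_fun setT h -> (forall z, 0 <= h z) ->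
  \int[mu]_z h z = \int[mu]_z \int[N]_s h (update z x s).
Proof.
move=> gx mh h0.
pose P := image_measure (N \x mu) (@measurable_update R J x).
transitivity (\int[P]_z h z).
  apply: eq_measure_integral => A mA _; apply: eq_measure_coords => //.
    by rewrite [X in X < _](_ : _ = mu setT)// probability_setT ltry.
  move=> B mB; rewrite [LHS]imu// (bigD1 x)//= gx// /P /= /pushforward.
  have -> : (fun p : measurableTypeR R * coords R J => update p.2 x p.1) @^-1` rectangle B =
      B x `*` rectangle (fun j => if j == x then setT else B j).
    apply/seteqP; split => -[s z] /=.
      move=> h1; split; first by have := h1 x; rewrite updateE.
      by move=> j; have := h1 j; rewrite /update; case: ifP.
    move=> [Bs h1] j; rewrite /update; have := h1 j.
    by case: eqP => [->|].
  have mBx : measurable (rectangle (fun j => if j == x then setT else B j) : set (coords R J)).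
    by apply: measurable_rectangle => j; case: ifP.
  rewrite (product_measure1E N mu (mB x) mBx).
  congr (_ * _); apply/esym; apply: (etrans (imu _)); first by move=> j; case: ifP.
  rewrite (bigD1 x)//= eqxx preimage_setT probability_setT mul1e.
  by apply: eq_bigr => j /negbTE ->.
rewrite ge0_integral_image_measure//.
have mhu := measurableT_comp mh (@measurable_update R J x).
rewrite (fubini_tonelli2 (m1 := N) (m2 := mu) _ mhu)// => p; exact: h0.
Qed.

Lemma coord_law_exists (x : J) :
  exists N : probability (measurableTypeR R) R, coord_law x N.
Proof.
have mx : @measurable_fun _ _ (coords R J) (measurableTypeR R) setT (coord x).
  exact: measurable_coord.
pose X := @mfun_Sub _ _ (coords R J) (measurableTypeR R) (coord x) (mem_set mx).
by exists (distribution mu X).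
Qed.

(** Once [x] is resampled, [f] sees only the fresh value and [h] does not see it, so the double
    integral factors. *)
Lemma integral_coordM (x : J) (f : R -> \bar R) (h : coords R J -> \bar R) :
  measurable_fun setT f -> (forall s, 0 <= f s) ->
  measurable_fun setT h -> (forall z, 0 <= h z) ->
  (forall z s, h (update z x s) = h z) ->
  \int[mu]_z (f (z x) * h z) = (\int[mu]_z f (z x)) * \int[mu]_z h z.
Proof.
move=> mf f0 mh h0 hx; have [N xN] := coord_law_exists x.
have mfx : measurable_fun setT (fun z : coords R J => f (z x)).
  exact: (measurableT_comp mf (measurable_coord x)).
have -> : \int[mu]_z f (z x) = \int[N]_s f s.
  rewrite (resample xN)//; under eq_integral do under eq_integral do rewrite updateE.
  by rewrite integral_cst//= probability_setT mule1.
rewrite (resample xN); first last.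
- by move=> z; apply: mule_ge0.
- exact: emeasurable_funM.
under eq_integral do under eq_integral do rewrite updateE hx.
rewrite -ge0_integralZl//; last exact: integral_ge0.
by apply: eq_integral => z _; rewrite ge0_integralZr.
Qed.

(** Resampling [x] turns [c] into a constant of the inner integral, where [normal_prob_shift]
    applies. *)
Lemma gaussian_shear (x : J) (c : coords R J -> R) (h : coords R J -> \bar R) :
  gaussian_coord x -> measurable_fun setT c ->
  (forall z s, c (update z x s) = c z) ->
  measurable_fun setT h -> (forall z, 0 <= h z) ->
  \int[mu]_z h (update z x (z x + c z)%R) =
  \int[mu]_z (h z * (expR (c z * z x - c z ^+ 2 / 2))%:E).
Proof.
move=> gx mc cE mh h0.
have m1 : measurable_fun setT (fun z : coords R J => update z x (z x + c z)%R).
  apply: measurable_coords => j; rewrite /update; case: (j == x).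
    by apply: measurable_funD => //; exact: measurable_coord.
  exact: measurable_coord.
rewrite (resample (N := normal_prob 0 1) gx)//; last exact: (measurableT_comp mh m1).
rewrite [RHS](resample (N := normal_prob 0 1) gx); first last.
- by move=> z; apply: mule_ge0 => //; rewrite lee_fin expR_ge0.
- apply: emeasurable_funM => //; apply/measurable_EFinP; apply: measurableT_comp => //.
  apply: measurable_funB => //; last first.
    by apply: measurable_funM => //; exact: measurable_funX.
  by apply: measurable_funM => //; exact: measurable_coord.
apply: eq_integral => z _.
under eq_integral do rewrite updateE update_update cE.
under [RHS]eq_integral do rewrite updateE cE.
have mz : measurable_fun [set: R] (fun s => h (update z x s)).
  apply: measurableT_comp => //.
  exact: (measurableT_comp (@measurable_update R J x) (pair2_measurable z)).
exact: (normal_prob_shift (c z) mz).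
Qed.

End resampling.

Section gaussian_invariance.
Context (R : realType) (J : finType) (mu : probability (coords R J) R).
Hypothesis imu : independent_coords mu.
Implicit Types (z : coords R J) (h : coords R J -> \bar R).

Definition shift_coords (s : seq J) (c : J -> coords R J -> R) (z : coords R J)
    : coords R J :=
  fun j => if j \in s then z j + c j z else z j.

Definition shift_exponent (s : seq J) (c : J -> coords R J -> R) (z : coords R J) : R :=
  \sum_(x <- s) (c x z * z x - c x z ^+ 2 / 2).

Lemma measurable_shift_coords s c : (forall x, measurable_fun setT (c x)) ->
  measurable_fun setT (shift_coords s c).
Proof.
move=> mc; apply: measurable_coords => j; rewrite /shift_coords; case: (j \in s).
  by apply: measurable_funD => //; exact: measurable_coord.
exact: measurable_coord.
Qed.

Lemma measurable_shift_exponent s c : (forall x, measurable_fun setT (c x)) ->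
  measurable_fun setT (shift_exponent s c).
Proof.
move=> mc; apply: measurable_sum => x; apply: measurable_funB.
  by apply: measurable_funM => //; exact: measurable_coord.
by apply: measurable_funM => //; exact: measurable_funX.
Qed.

Lemma eq_coords A (h : coords R J -> A) z z' : (forall j, z j = z' j) -> h z = h z'.
Proof. by move=> zz'; congr h; apply/funext => j; exact: zz'. Qed.

Local Open Scope ereal_scope.

(** Cameron-Martin in several coordinates, one shear at a time. The set [D] is kept apart from [s]
    because the induction shortens [s], while [c] has to keep ignoring every coordinate that was
    shifted. *)
Lemma gaussian_shift (D : {pred J}) (s : seq J) (c : J -> coords R J -> R) h :
  uniq s -> (forall x, x \in s -> x \in D) ->
  (forall x, x \in s -> gaussian_coord mu x) ->
  (forall x, measurable_fun setT (c x)) ->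
  (forall x z z', (forall j, j \notin D -> z j = z' j) -> c x z = c x z') ->
  measurable_fun setT h -> (forall z, 0 <= h z) ->
  \int[mu]_z h (shift_coords s c z) =
  \int[mu]_z (h z * (expR (shift_exponent s c z))%:E).
Proof.
move=> + + + mc cD; elim: s h => [|x s IH] h.
  move=> _ _ _ mh h0; apply: eq_integral => z _.
  rewrite /shift_exponent big_nil expR0 mule1; apply: eq_coords => j.
  by rewrite /shift_coords.
move=> /= /andP[xs us] sD gs mh h0.
have xD : x \in D by apply: sD; rewrite mem_head.
have gx : gaussian_coord mu x by apply: gs; rewrite mem_head.
have cx y z t : c y (update z x t) = c y z.
  by apply: cD => j jD; rewrite /update; case: eqP => // jx; rewrite jx xD in jD.
pose h1 z := h (update z x (z x + c x z)%R).
have mupd : measurable_fun setT (fun z : coords R J => update z x (z x + c x z)%R).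
  apply: measurable_coords => j; rewrite /update; case: (j == x).
    by apply: measurable_funD => //; exact: measurable_coord.
  exact: measurable_coord.
(* The coordinates of [s] move first and [x] last; [c x] ignores [D], so it has the same value
   before and after the first move. *)
transitivity (\int[mu]_z h1 (shift_coords s c z)).
  apply: eq_integral => z _; rewrite /h1; apply: eq_coords => j.
  rewrite /update /shift_coords in_cons (negbTE xs).
  case: eqP => [->|//] /=; congr (_ + _)%R; apply: cD => k kD.
  by case: ifPn => // ks; rewrite sD// in_cons ks orbT in kD.
have mh1 : measurable_fun setT h1 by exact: (measurableT_comp mh mupd).
have sD' y : y \in s -> y \in D by move=> ys; apply: sD; rewrite in_cons ys orbT.
have gs' y : y \in s -> gaussian_coord mu y by move=> ys; apply: gs; rewrite in_cons ys orbT.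
rewrite (IH h1 us sD' gs' mh1 (fun z => h0 _)).
have eE z t : shift_exponent s c (update z x t) = shift_exponent s c z.
  rewrite /shift_exponent !big_seq; apply: eq_bigr => y ys; rewrite cx /update.
  by case: eqP => // yx; rewrite -yx ys in xs.
pose k z := h z * (expR (shift_exponent s c z))%:E.
transitivity (\int[mu]_z k (update z x (z x + c x z)%R)).
  by apply: eq_integral => z _; rewrite /k /h1 eE.
have mk : measurable_fun setT k.
  apply: emeasurable_funM => //; apply/measurable_EFinP; apply: measurableT_comp => //.
  exact: measurable_shift_exponent.
have k0 z : 0 <= k z by apply: mule_ge0 => //; rewrite lee_fin expR_ge0.
rewrite (gaussian_shear imu gx (mc x) (fun z t => cx x z t) mk k0).
apply: eq_integral => z _; rewrite /k -muleA -EFinM -expRD.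
by rewrite /shift_exponent big_cons addrC.
Qed.

Definition plane_weight (x y : J) z : R := expR ((z x ^+ 2 + z y ^+ 2) / 2).

Lemma plane_weightC x y z : plane_weight x y z = plane_weight y x z.
Proof. by rewrite /plane_weight addrC. Qed.

(* Against the weight, the Gaussian plane has constant density, which a shear preserves. *)
Lemma plane_shear (x y : J) (a : R) h :
  x != y -> gaussian_coord mu x -> measurable_fun setT h -> (forall z, 0 <= h z) ->
  \int[mu]_z (h (update z x (z x + a * z y)%R) * (plane_weight x y z)%:E) =
  \int[mu]_z (h z * (plane_weight x y z)%:E).
Proof.
move=> xy gx mh h0.
(* The exponent is that of the plane weight after undoing the shear, so composing [k] with the shear
   restores the weight. The Cameron-Martin factor then changes this exponent back into
   [(z x ^+ 2 + z y ^+ 2) / 2]. *)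
pose k z := h z * (expR (((z x - a * z y) ^+ 2 + z y ^+ 2) / 2))%:E.
have mE : measurable_fun setT
    (fun z : coords R J => expR (((z x - a * z y) ^+ 2 + z y ^+ 2) / 2)).
  apply: measurableT_comp => //; apply: measurable_funM => //.
  apply: measurable_funD; apply: measurable_funX; last exact: measurable_coord.
  apply: measurable_funB; first exact: measurable_coord.
  by apply: measurable_funM => //; exact: measurable_coord.
have yx : (y == x) = false by rewrite eq_sym (negbTE xy).
transitivity (\int[mu]_z k (update z x (z x + a * z y)%R)).
  apply: eq_integral => z _; rewrite /k /update eqxx yx; congr (_ * (expR (_ / 2))%:E).
  by ring.
rewrite (gaussian_shear imu (c := fun z => (a * z y)%R) gx).
- apply: eq_integral => z _; rewrite /k -muleA -EFinM -expRD.
  by congr (_ * (expR _)%:E); field.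
- by apply: measurable_funM => //; exact: measurable_coord.
- by move=> z s; rewrite /update yx.
- by apply: emeasurable_funM => //; exact/measurable_EFinP.
- by move=> z; apply: mule_ge0 => //; rewrite lee_fin expR_ge0.
Qed.

(** Sine and cosine in terms of the tangent [u] of the half angle. Being rational in [u], they leave
    trigonometric identities to [field] and [nra]. *)
Definition rsin (u : R) : R := 2 * u / (1 + u ^+ 2).
Definition rcos (u : R) : R := (1 - u ^+ 2) / (1 + u ^+ 2).

Definition plane_rotation (u : R) (x y : J) z : coords R J :=
  fun j => (if j == x then rcos u * z x - rsin u * z y
            else if j == y then rsin u * z x + rcos u * z y else z j)%R.

Lemma rcos2Drsin2 u : (rcos u ^+ 2 + rsin u ^+ 2 = 1)%R.
Proof.
rewrite /rcos /rsin; field.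
by rewrite gt_eqF// ltr_wpDr ?sqr_ge0.
Qed.

Lemma measurable_plane_rotation u x y : measurable_fun setT (plane_rotation u x y).
Proof.
apply: measurable_coords => j; rewrite /plane_rotation.
case: (j == x); [apply: measurable_funB|case: (j == y); [apply: measurable_funD|]];
  rewrite ?(measurable_coord)//; try exact: measurable_coord;
  by apply: measurable_funM => //; exact: measurable_coord.
Qed.

(* A rotation is a product of three shears. *)
Lemma integral_plane_rotation u (x y : J) h :
  x != y -> gaussian_coord mu x -> gaussian_coord mu y ->
  measurable_fun setT h -> (forall z, 0 <= h z) ->
  \int[mu]_z h (plane_rotation u x y z) = \int[mu]_z h z.
Proof.
move=> xy gx gy mh h0.
have yx : (y == x) = false by rewrite eq_sym (negbTE xy).
have u0 : (1 + u ^+ 2 != 0)%R by rewrite gt_eqF// ltr_wpDr ?sqr_ge0.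
pose w z := (plane_weight x y z)%:E.
(* [k] is [h] divided by the plane weight. The weight depends only on the radius, so the rotation
   fixes it and the shears act on [k] alone. *)
pose k z := h z * (expR (- ((z x ^+ 2 + z y ^+ 2) / 2)))%:E.
have mk : measurable_fun setT k.
  apply: emeasurable_funM => //; apply/measurable_EFinP; apply: measurableT_comp => //.
  apply: measurableT_comp => //; apply: measurable_funM => //.
  by apply: measurable_funD; apply: measurable_funX; exact: measurable_coord.
have k0 z : 0 <= k z by apply: mule_ge0 => //; rewrite lee_fin expR_ge0.
have kE z : h z = k z * w z.
  by rewrite /k /w /plane_weight -muleA -EFinM -expRD addNr expR0 mule1.
have mS (p q : J) (a : R) : measurable_fun setT
    (fun z : coords R J => update z p (z p + a * z q)%R : coords R J).
  apply: measurable_coords => j; rewrite /update; case: (j == p).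
    apply: measurable_funD; first exact: measurable_coord.
    by apply: measurable_funM => //; exact: measurable_coord.
  exact: measurable_coord.
(* The factors are the shear by minus the tangent of the half angle, the shear by the sine, and the
   first one again. *)
pose S1 z : coords R J := update z x (z x + - u * z y)%R.
pose S2 z : coords R J := update z y (z y + rsin u * z x)%R.
have RE z : plane_rotation u x y z = S1 (S2 (S1 z)).
  apply/funext => j; rewrite /plane_rotation /S1 /S2 /update !eqxx yx (negbTE xy).
  case: (eqVneq j x) => [_|jx]; first by rewrite /rcos /rsin; field.
  by case: (eqVneq j y) => // _; rewrite /rcos /rsin; field.
transitivity (\int[mu]_z (k (S1 (S2 (S1 z))) * w z)).
  apply: eq_integral => z _; rewrite kE RE; congr (_ * (expR (_ / 2))%:E).
  rewrite -RE /plane_rotation !eqxx yx.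
  transitivity ((rcos u ^+ 2 + rsin u ^+ 2) * (z x ^+ 2 + z y ^+ 2))%R; first by ring.
  by rewrite rcos2Drsin2 mul1r.
have m1 : measurable_fun setT (fun z => k (S1 z)) by exact: (measurableT_comp mk (mS _ _ _)).
have m2 : measurable_fun setT (fun z => k (S1 (S2 z))) by exact: (measurableT_comp m1 (mS _ _ _)).
rewrite (@plane_shear x y _ (fun z => k (S1 (S2 z))))//.
transitivity (\int[mu]_z (k (S1 z) * w z)).
  rewrite /w; under eq_integral do rewrite plane_weightC.
  under [RHS]eq_integral do rewrite plane_weightC.
  by rewrite (@plane_shear y x _ (fun z => k (S1 z)))// yx.
rewrite (@plane_shear x y _ k)//.
by apply: eq_integral => z _; rewrite -kE.
Qed.

Fixpoint plane_rotations (u : R) (s : seq (J * J)) z : coords R J :=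
  if s is e :: s' then plane_rotation u e.1 e.2 (plane_rotations u s' z) else z.

Lemma measurable_plane_rotations u s : measurable_fun setT (plane_rotations u s).
Proof.
elim: s => [|e s IH]; first exact: measurable_id.
exact: (measurableT_comp (measurable_plane_rotation u e.1 e.2) IH).
Qed.

Lemma integral_plane_rotations u (s : seq (J * J)) h :
  (forall e, e \in s -> [/\ e.1 != e.2, gaussian_coord mu e.1 & gaussian_coord mu e.2]) ->
  measurable_fun setT h -> (forall z, 0 <= h z) ->
  \int[mu]_z h (plane_rotations u s z) = \int[mu]_z h z.
Proof.
elim: s h => [//|e s IH] h hs mh h0 /=.
have [e12 g1 g2] := hs e (mem_head _ _).
rewrite (IH (fun z => h (plane_rotation u e.1 e.2 z)))//.
- exact: integral_plane_rotation.
- by move=> f fs; apply: hs; rewrite in_cons fs orbT.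
- exact: (measurableT_comp mh (measurable_plane_rotation u e.1 e.2)).
Qed.

End gaussian_invariance.

(** * Chi-square bound for a Gaussian shift *)

Section expectation.
Context d (T : measurableType d) (R : realType) (mu : probability T R).
Implicit Types f g : T -> R.

Definition intble f := mu.-integrable setT (EFin \o f).

Lemma bounded_intble (f : T -> R) (K : R) : measurable_fun setT f ->
  (forall x, `|f x| <= K) -> intble f.
Proof.
move=> mf fK; apply: measurable_bounded_integrable => //.
  by rewrite (le_lt_trans (probability_le1 mu measurableT))// ltry.
exists K; split; first exact: num_real.
by move=> x Kx y _ /=; apply: (le_trans (fK y)); exact: ltW.
Qed.

Lemma intble_ge0 f : measurable_fun setT f -> (forall x, 0 <= f x) ->
  (\int[mu]_x (f x)%:E < +oo)%E -> intble f.
Proof.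
move=> mf f0 fi; apply/integrableP; split; first exact/measurable_EFinP.
by under eq_integral => x _ do rewrite /= ger0_norm ?f0//.
Qed.

Lemma intbleD f g : intble f -> intble g -> intble (fun x => f x + g x).
Proof. by move=> fi gi; exact: (integrableD _ fi gi). Qed.

Lemma intbleZ (a : R) f : intble f -> intble (fun x => a * f x).
Proof. by move=> fi; exact: (integrableZl measurableT a fi). Qed.

Lemma intbleB f g : intble f -> intble g -> intble (fun x => f x - g x).
Proof. by move=> fi gi; exact: (integrableB _ fi gi). Qed.

Lemma Rintegral_ge0E f : measurable_fun setT f -> (forall x, 0 <= f x) ->
  intble f -> ((\int[mu]_x f x)%:E = \int[mu]_x (f x)%:E)%E.
Proof. by move=> mf f0 fi; rewrite fineK//; exact: integrable_fin_num. Qed.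

End expectation.

Section chi_square.
Context (R : realType) (J : finType) (mu : probability (coords R J) R).
Hypothesis imu : independent_coords mu.
Implicit Types (z : coords R J).
Variables (D : {pred J}) (s : seq J) (c : J -> coords R J -> R).
Hypotheses (us : uniq s) (sD : forall x, x \in s -> x \in D).
Hypothesis gs : forall x, x \in s -> gaussian_coord mu x.
Hypothesis mc : forall x, measurable_fun setT (c x).
Hypothesis cD : forall x z z', (forall j, j \notin D -> z j = z' j) -> c x z = c x z'.
Variables (g : coords R J -> bool).
Hypothesis mg : measurable_fun setT g.
Hypothesis gD : forall z z', (forall j, j \notin D -> z j = z' j) -> g z = g z'.
Let q z := \sum_(x <- s) c x z ^+ 2.
Variables (M : R).
Hypothesis qM : forall z, g z -> q z <= M.
Let w z : R := (g z)%:R.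
Let L z : R := expR (shift_exponent s c z).

Let mw : measurable_fun setT w.
Proof.
rewrite /w (_ : (fun z => _) = (fun z => if g z then 1 else 0)).
  by apply: measurable_fun_ifT.
by apply/funext => z; case: (g z).
Qed.

Let mL : measurable_fun setT L.
Proof. by apply: measurableT_comp => //; exact: measurable_shift_exponent. Qed.

Let mq : measurable_fun setT q.
Proof. by apply: measurable_sum => x; exact: measurable_funX. Qed.

Let shift_off (b : J -> coords R J -> R) z j : j \notin D -> shift_coords s b z j = z j.
Proof. by move=> jD; rewrite /shift_coords; case: ifPn => // /sD; rewrite (negbTE jD). Qed.

Let w_shift b z : w (shift_coords s b z) = w z.
Proof. by rewrite /w (gD (shift_off b z)). Qed.

Let q_shift b z : q (shift_coords s b z) = q z.
Proof. by apply: eq_bigr => x _; rewrite (cD _ (shift_off b z)). Qed.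

Let w_ge0 z : 0 <= w z. Proof. by rewrite /w ler0n. Qed.
Let L_ge0 z : 0 <= L z. Proof. exact: expR_ge0. Qed.
Let int_wL : (\int[mu]_z (w z * L z)%:E = \int[mu]_z (w z)%:E)%E.
Proof.
under eq_integral do rewrite EFinM.
rewrite -(gaussian_shift imu (h := fun z => (w z)%:E) us sD gs mc cD).
- by apply: eq_integral => z _; rewrite w_shift.
- exact/measurable_EFinP.
- by move=> z; rewrite lee_fin.
Qed.

(** [L ^+ 2] is [expR q] times the likelihood ratio of the doubled shift [2 * c], and neither [w]
    nor [q] feels that shift. *)
Let int_wL2 : (\int[mu]_z (w z * L z ^+ 2)%:E = \int[mu]_z (w z * expR (q z))%:E)%E.
Proof.
pose c2 x z := 2 * c x z.
transitivity (\int[mu]_z ((w z * expR (q z))%:E * (expR (shift_exponent s c2 z))%:E)%E)%E.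
  apply: eq_integral => z _; rewrite -EFinM -mulrA -expRD; congr (_ * _)%:E.
  rewrite /L -expRM_natl; congr expR.
  rewrite /q /shift_exponent -big_split/= mulr_sumr; apply: eq_bigr => x _.
  by rewrite /c2; field.
rewrite -(gaussian_shift imu (h := fun z => (w z * expR (q z))%:E) us sD gs).
- by apply: eq_integral => z _; rewrite w_shift q_shift.
- by move=> x; apply: measurable_funM.
- by move=> x z z' /cD; rewrite /c2 => ->.
- by apply/measurable_EFinP; apply: measurable_funM => //; exact: measurableT_comp.
- by move=> z; rewrite lee_fin mulr_ge0// expR_ge0.
Qed.

Let i_w : intble mu w.
Proof. by apply: (@bounded_intble _ _ _ mu _ (1)) => // z; rewrite /w normr_nat lern1 leq_b1. Qed.

Let i_wq : intble mu (fun z => w z * expR (q z)).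
Proof.
apply: (@bounded_intble _ _ _ mu _ (expR M)).
  by apply: measurable_funM => //; exact: measurableT_comp.
move=> z; rewrite /w ger0_norm ?mulr_ge0 ?expR_ge0//.
case: (boolP (g z)) => gz; last by rewrite mul0r expR_ge0.
by rewrite mul1r ler_expR qM.
Qed.

Let i_wL : intble mu (fun z => w z * L z).
Proof.
apply: intble_ge0.
- exact: measurable_funM.
- by move=> z; rewrite mulr_ge0.
- rewrite int_wL; apply: (integrable_lty _ i_w) => //.
Qed.

Let i_wL2 : intble mu (fun z => w z * L z ^+ 2).
Proof.
apply: intble_ge0.
- by apply: measurable_funM => //; exact: measurable_funX.
- by move=> z; rewrite mulr_ge0// sqr_ge0.
- rewrite int_wL2; apply: (integrable_lty _ i_wq) => //.
Qed.

(** The shift turns the second expectation into that of [F * L]. Young's inequality with weight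
    [theta] splits [2 * F * (1 - L)], and the expectation of [(L - 1) ^+ 2] on [g] is the chi-square
    divergence in the last bracket. The event [g] is where the shift has bounded size. *)
Lemma chi_square_shift (F : coords R J -> R) (K theta : R) :
  0 < theta -> measurable_fun setT F -> (forall z, `|F z| <= K) ->
  (forall z, ~~ g z -> F z = 0) ->
  2 * (\int[mu]_z F z - \int[mu]_z F (shift_coords s c z)) <=
  theta * \int[mu]_z (F z ^+ 2) +
  theta^-1 * (\int[mu]_z ((g z)%:R * expR (q z)) - \int[mu]_z (g z)%:R).
Proof.
move=> th0 mF FK Fg.
have K0 : 0 <= K by apply: le_trans (FK point); exact: normr_ge0.
have i_F : intble mu F by exact: (@bounded_intble _ _ _ mu _ K mF FK).
have mS := measurable_shift_coords s mc.
have mFS : measurable_fun setT (fun z => F (shift_coords s c z)).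
  exact: (measurableT_comp mF mS).
have i_FS : intble mu (fun z => F (shift_coords s c z)).
  exact: (@bounded_intble _ _ _ mu _ K mFS (fun z => FK _)).
have i_F2 : intble mu (fun z => F z ^+ 2).
  apply: (@bounded_intble _ _ _ mu _ (K ^+ 2)); first exact: measurable_funX.
  by move=> z; rewrite normrX; apply: lerXn2r; rewrite ?nnegrE.
have i_wS : intble mu (fun z => w (shift_coords s c z)).
  by rewrite (_ : (fun z => _) = w)//; apply: funext => z; exact: w_shift.
(* [F] has no sign while the shift formula is for nonnegative functions; adding [K] on [g] repairs
   this, and the added term has the same integral with or without [L]. *)
pose G z := F z + K * w z.
have G0 z : 0 <= G z.
  rewrite /G /w; case: (boolP (g z)) => gz; last by rewrite Fg// mulr0 addr0.
  by rewrite mulr1; have := FK z; rewrite ler_norml => /andP[]; rewrite -subr_ge0 opprK.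
have mG : measurable_fun setT G by apply: measurable_funD => //; exact: measurable_funM.
have GS : (\int[mu]_z (G z * L z)%:E = \int[mu]_z (G (shift_coords s c z))%:E)%E.
  under eq_integral do rewrite EFinM.
  rewrite -(gaussian_shift imu (h := fun z => (G z)%:E) us sD gs mc cD)//.
  exact/measurable_EFinP.
have i_GS : intble mu (fun z => G (shift_coords s c z)).
  by apply: (intbleD i_FS); exact: intbleZ.
have i_GL : intble mu (fun z => G z * L z).
  apply: intble_ge0.
  - exact: measurable_funM.
  - by move=> z; rewrite mulr_ge0.
  - by rewrite GS; apply: (integrable_lty _ i_GS).
have E1 : \int[mu]_z (G z * L z) =
    \int[mu]_z F (shift_coords s c z) + K * \int[mu]_z w z.
  transitivity (\int[mu]_z G (shift_coords s c z)); first by rewrite /Rintegral GS.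
  rewrite /G RintegralD//; last exact: intbleZ.
  by congr (_ + _); rewrite RintegralZl//; congr (_ * _); apply: eq_Rintegral => z _; exact: w_shift.
have E2 : \int[mu]_z (w z * L z) = \int[mu]_z w z by rewrite /Rintegral int_wL.
have E3 : \int[mu]_z (w z * L z ^+ 2) = \int[mu]_z (w z * expR (q z)).
  by rewrite /Rintegral int_wL2.
pose lhs z := 2 * (F z - (G z * L z - K * (w z * L z))).
pose rhs z := theta * F z ^+ 2 + theta^-1 * (w z * L z ^+ 2 - 2 * (w z * L z) + w z).
have i_b : intble mu (fun z => G z * L z - K * (w z * L z)).
  by apply: intbleB => //; exact: intbleZ.
have i_a : intble mu (fun z => F z - (G z * L z - K * (w z * L z))).
  by apply: intbleB.
have i_c : intble mu (fun z => w z * L z ^+ 2 - 2 * (w z * L z)).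
  by apply: intbleB => //; exact: intbleZ.
have i_d : intble mu (fun z => w z * L z ^+ 2 - 2 * (w z * L z) + w z).
  by apply: intbleD.
have : \int[mu]_z lhs z <= \int[mu]_z rhs z.
  apply: le_Rintegral => //.
  - exact: intbleZ.
  - by apply: intbleD; exact: intbleZ.
  move=> z _; rewrite /lhs /rhs /G /w.
  case: (boolP (g z)) => gz; last first.
    by rewrite Fg// !(mul0r, mulr0, addr0, add0r, subr0, oppr0, expr0n).
  (* On [g] this weighted square is exactly [rhs - lhs]. *)
  have : 0 <= theta^-1 * (theta * F z + (L z - 1)) ^+ 2.
    by rewrite mulr_ge0 ?sqr_ge0// invr_ge0 ltW.
  have -> : theta^-1 * (theta * F z + (L z - 1)) ^+ 2 = theta * F z ^+ 2
      + 2 * F z * (L z - 1) + theta^-1 * (L z - 1) ^+ 2 by field; rewrite gt_eqF.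
  rewrite !mulr1 !mul1r (_ : true%:R = 1 :> R)// => H.
  by rewrite -subr_ge0; apply: (le_trans H); rewrite le_eqVlt; apply/orP; left; apply/eqP; ring.
rewrite /lhs /rhs RintegralZl// RintegralB// RintegralB//; last exact: intbleZ.
rewrite RintegralZl// RintegralD//; [|exact: intbleZ|exact: intbleZ].
rewrite RintegralZl// RintegralZl// RintegralD// RintegralB//; last exact: intbleZ.
rewrite RintegralZl// E1 E2 E3 /w.
set I1 := \int[mu]_z F z; set I2 := \int[mu]_z F _; set I3 := \int[mu]_z (_%:R).
set I4 := \int[mu]_z (F z ^+ 2); set I5 := \int[mu]_z (_ * _).
by rewrite addrK (_ : I5 - 2 * I3 + I3 = I5 - I3)//; ring.
Qed.

End chi_square.

(** * Alignment and plane rotations *)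

Section squared_frobenius.
Context (R : realType) (d : nat).
Implicit Types A B : 'M[R]_d.

Definition sqfrob A : R := \sum_(a < d) \sum_(b < d) A a b ^+ 2.

Lemma sqfrob_ge0 A : 0 <= sqfrob A.
Proof. by do 2 (apply: sumr_ge0 => ? _); exact: sqr_ge0. Qed.

Lemma sqfrobE A : sqfrob A = \tr (A *m A^T).
Proof.
by apply: eq_bigr => a _; rewrite mxE; apply: eq_bigr => b _; rewrite mxE expr2.
Qed.

Lemma frob_sqr A : frob A ^+ 2 = sqfrob A.
Proof. by rewrite sqr_sqrtr// sqfrob_ge0. Qed.

Lemma sqfrobB A B : sqfrob (A - B) = sqfrob A - 2 * \tr (A *m B^T) + sqfrob B.
Proof.
rewrite !sqfrobE [(A - B)^T]raddfB/= mulmxBl !mulmxBr !(raddfB (@mxtrace R d))/=.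
by rewrite -[\tr (B *m A^T)]mxtrace_tr trmx_mul trmxK; ring.
Qed.

Lemma sqfrob_orthl A B : A^T *m A = 1%:M -> sqfrob (A *m B) = sqfrob B.
Proof.
move=> AA; rewrite !sqfrobE trmx_mul mulmxA mxtrace_mulC.
by rewrite mulmxA mulmxA AA mul1mx.
Qed.

Lemma sqfrob_orthr A B : A *m A^T = 1%:M -> sqfrob (B *m A) = sqfrob B.
Proof. by move=> AA; rewrite !sqfrobE trmx_mul mulmxA -[_ *m _ *m A^T]mulmxA AA mulmx1. Qed.

Lemma sqfrobT A : sqfrob A^T = sqfrob A.
Proof. by rewrite !sqfrobE trmxK mxtrace_mulC. Qed.

Lemma sqfrob_SO A : SO A -> sqfrob A = d%:R.
Proof. by case=> AA _ _; rewrite sqfrobE AA mxtrace1. Qed.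

Lemma SO_mul A B : SO A -> SO B -> SO (A *m B).
Proof.
move=> [a1 a2 a3] [b1 b2 b3]; split; last by rewrite det_mulmx a3 b3 mulr1.
  by rewrite trmx_mul mulmxA -[A *m B *m _]mulmxA b1 mulmx1.
by rewrite trmx_mul mulmxA -[_ *m A^T *m A]mulmxA a2 mulmx1.
Qed.

Lemma SO_tr A : SO A -> SO A^T.
Proof. by move=> [a1 a2 a3]; split; rewrite ?trmxK ?det_tr. Qed.

End squared_frobenius.

Section aligned_products.
Context (R : realType) (n d : nat).
Hypothesis n0 : (0 < n)%N.
Implicit Types Zh Z : 'I_n -> 'M[R]_d.

Definition alignment Zh Z : 'M[R]_d :=
  n%:R^-1 *: \sum_(j < n) (Zh j)^T *m Z j.

Definition aligned_product Zh Z (i : 'I_n) : 'M[R]_d :=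
  Zh i *m alignment Zh Z *m (Z i)^T.

Definition misalignment Zh Z : R := d%:R - sqfrob (alignment Zh Z).

Let nR0 : n%:R != 0 :> R. Proof. by rewrite pnatr_eq0 -lt0n. Qed.

(* The minimum over rotations is at least the least-squares minimum over all matrices. *)
Lemma misalignment_le_loss Zh Z : SOn Zh -> SOn Z -> misalignment Zh Z <= loss Zh Z.
Proof.
move=> hZh hZ; have [B hB [-> _]] := loss_min Zh Z.
rewrite /misalignment /aligned_loss.
have -> : \sum_(i < n) frob (Zh i - Z i *m B) ^+ 2 =
    n%:R * (2 * d%:R - 2 * \tr (alignment Zh Z *m B)).
  transitivity (\sum_(i < n) (2 * d%:R - 2 * \tr ((Zh i)^T *m Z i *m B))).
    apply: eq_bigr => i _; have [_ ZZ _] := hZ i.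
    rewrite frob_sqr sqfrobB (sqfrob_SO (hZh i)) sqfrob_orthl// (sqfrob_SO hB).
    by rewrite -[\tr (Zh i *m _)]mxtrace_tr trmx_mul trmxK -mulmxA mxtrace_mulC; ring.
  rewrite sumrB sumr_const card_ord -mulr_sumr -(raddf_sum (@mxtrace R d)) -mulmx_suml.
  rewrite /alignment -scalemxAl mxtraceZ -[_ *+ n]mulr_natl.
  by field.
rewrite mulKf//.
(* Completing the square: the loss at [B] exceeds the misalignment by exactly this squared norm. *)
have := sqfrob_ge0 (alignment Zh Z - B^T).
by rewrite sqfrobB trmxK sqfrobT (sqfrob_SO hB); lra.
Qed.

Lemma sum_mxtrace_aligned Zh Z :
  \sum_(i < n) \tr (aligned_product Zh Z i) = n%:R * sqfrob (alignment Zh Z).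
Proof.
under eq_bigr do rewrite /aligned_product mxtrace_mulC mulmxA.
rewrite -(raddf_sum (@mxtrace R d)) -mulmx_suml -sqfrobT sqfrobE trmxK.
have -> : (alignment Zh Z)^T = n%:R^-1 *: (\sum_(j < n) (Zh j)^T *m Z j)^T by rewrite linearZ.
rewrite -[in RHS]scalemxAl mxtraceZ mulVKf//.
congr (\tr (_ *m _)); rewrite linear_sum/=; apply: eq_bigr => j _.
by rewrite trmx_mul trmxK.
Qed.

(** [Zh i] and [Z i] are orthogonal, so every aligned product has the norm of the alignment.
    Expanding the squares leaves only the trace sum of [sum_mxtrace_aligned]. *)
Lemma sum_sqfrob_aligned Zh Z : SOn Zh -> SOn Z ->
  \sum_(i < n) sqfrob (1%:M - aligned_product Zh Z i) = n%:R * misalignment Zh Z.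
Proof.
move=> hZh hZ.
transitivity (\sum_(i < n) (d%:R - 2 * \tr (aligned_product Zh Z i)
    + sqfrob (alignment Zh Z))).
  apply: eq_bigr => i _; have [_ ZZ _] := hZ i; have [_ ZZh _] := hZh i.
  rewrite sqfrobB mul1mx mxtrace_tr (sqfrob_SO (SO1 _ _)).
  by rewrite [in X in _ + X]/aligned_product sqfrob_orthr ?trmxK// sqfrob_orthl.
rewrite big_split sumrB/= !sumr_const card_ord -mulr_sumr sum_mxtrace_aligned.
by rewrite /misalignment -[d%:R *+ n]mulr_natl -[sqfrob _ *+ n]mulr_natl; ring.
Qed.

Definition skew_entry (A : 'M[R]_d) (k l : 'I_d) : R := A k l - A l k.

(** Each pair uses [(a - b)^2 <= 2 (a^2 + b^2)], and the diagonal of [1%:M - A] is dropped. Equality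
    holds when [1%:M - A] is skew, the leading-order shape of a rotation error, so the sharp
    constant survives. *)
Lemma sum_skew_entry (A : 'M[R]_d) :
  \sum_(k < d) \sum_(l < d | (k < l)%N) skew_entry A k l ^+ 2 <= 2 * sqfrob (1%:M - A).
Proof.
pose B := 1%:M - A.
have off (k l : 'I_d) : (k < l)%N -> skew_entry A k l ^+ 2 <= 2 * (B k l ^+ 2 + B l k ^+ 2).
  move=> kl; have ne : (k == l) = false by apply/negbTE; rewrite neq_ltn kl.
  rewrite /skew_entry /B !mxE ne eq_sym ne !sub0r !sqrrN.
  by rewrite -subr_ge0; have := sqr_ge0 (A k l + A l k); lra.
apply: (@le_trans _ _ (\sum_(k < d) \sum_(l < d | (k < l)%N) 2 * (B k l ^+ 2 + B l k ^+ 2))).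
  by apply: ler_sum => k _; apply: ler_sum => l; exact: off.
under eq_bigr do rewrite -mulr_sumr big_split/=.
rewrite -mulr_sumr ler_pM2l// big_split/=.
rewrite [X in _ + X](exchange_big_dep xpredT)//= -big_split/=.
apply: ler_sum => k _.
rewrite [leRHS](bigID (fun l : 'I_d => (k < l)%N))/= lerD2l.
rewrite [leRHS](bigID (fun l : 'I_d => (l < k)%N))/=.
apply: le_trans (_ : \sum_(l < d | (l < k)%N) B k l ^+ 2 <= _).
  by [].
rewrite [X in X + _](eq_bigl (fun l : 'I_d => (l < k)%N)).
  by rewrite lerDl; apply: sumr_ge0 => l _; exact: sqr_ge0.
by move=> l /=; case: ltngtP.
Qed.

Lemma sum_diag_pairs (A : 'M[R]_d) :
  \sum_(k < d) \sum_(l < d | (k < l)%N) (A k k + A l l) = (d%:R - 1) * \tr A.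
Proof.
under eq_bigr do rewrite big_split/=.
rewrite big_split/= [X in _ + X](exchange_big_dep xpredT)//= -big_split/=.
rewrite /mxtrace mulr_sumr; apply: eq_bigr => k _.
transitivity (\sum_(l < d | l != k) A k k).
  rewrite [RHS](bigID (fun l : 'I_d => (k < l)%N))/=; congr (_ + _);
    apply: eq_bigl => l; rewrite -val_eqE /=; case: ltngtP => //.
rewrite (eq_bigl (fun l => l \in predC1 k))// sumr_const cardC1 card_ord.
rewrite -[A k k *+ _]mulr_natl; congr (_ * _).
by case: (d) k => [[]//|m] _; rewrite -natr1 addrK.
Qed.

End aligned_products.

Section givens.
Context (R : realType) (d : nat) (u : R) (k l : 'I_d).
Hypothesis kl : k != l.

Definition shear_mx (a : R) (x y : 'I_d) : 'M[R]_d := 1%:M + a *: delta_mx x y.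

Lemma shear_mx_mul a x y (A : 'M[R]_d) i j :
  (shear_mx a x y *m A) i j = A i j + (i == x)%:R * (a * A y j).
Proof.
rewrite mulmxDl mul1mx mxE; congr (_ + _); rewrite -scalemxAl mxE mulrCA; congr (_ * _).
rewrite mxE (bigD1 y)//= big1 ?addr0 ?mxE ?eqxx ?andbT// => m my.
by rewrite mxE (negbTE my) andbF mul0r.
Qed.

Lemma det_shear_mx a x y : x != y -> \det (shear_mx a x y) = 1.
Proof.
have lower (p q : 'I_d) : (q < p)%N -> \det (shear_mx a p q) = 1.
  move=> qp; have pq : (p == q) = false by apply/negbTE; rewrite neq_ltn qp orbT.
  rewrite det_trig; last first.
    apply/is_trig_mxP => i j ij; rewrite !mxE (_ : (i == j) = false) ?add0r; last first.
      by apply/negbTE; rewrite neq_ltn ij.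
    case: eqP => [ip|_]; last by rewrite mulr0.
    case: eqP => [jq|_]; last by rewrite mulr0.
    by move: ij; rewrite ip jq ltnNge ltnW.
  rewrite big1// => i _; rewrite !mxE eqxx.
  case: (eqVneq i p) => [->|]; last by rewrite mulr0 addr0.
  by rewrite pq mulr0 addr0.
rewrite neq_ltn => /orP[xy|]; last exact: lower.
rewrite -det_tr (_ : (shear_mx a x y)^T = shear_mx a y x) ?lower//.
by apply/matrixP => i j; rewrite !mxE eq_sym andbC.
Qed.

(** The same three shears as for coordinates. Defined this way its determinant is visibly 1; the
    usual entries are recovered in [givensE]. *)
Definition givens : 'M[R]_d := shear_mx (- u) k l *m shear_mx (rsin u) l k *m shear_mx (- u) k l.

Let u0 : 1 + u ^+ 2 != 0. Proof. by rewrite gt_eqF// ltr_wpDr ?sqr_ge0. Qed.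

Lemma givens_mul (A : 'M[R]_d) i j : (givens *m A) i j =
  if i == k then rcos u * A k j - rsin u * A l j
  else if i == l then rsin u * A k j + rcos u * A l j else A i j.
Proof.
have lk : (l == k) = false by rewrite eq_sym (negbTE kl).
rewrite /givens -!mulmxA !shear_mx_mul ?eqxx ?lk ?(negbTE kl).
case: (eqVneq i k) => [->|ik]; first by rewrite (negbTE kl) /rcos /rsin /=; field.
by case: (eqVneq i l) => [->|_]; rewrite /rcos /rsin /=; field.
Qed.

Lemma givensE i j : givens i j =
  if i == k then rcos u * (k == j)%:R - rsin u * (l == j)%:R
  else if i == l then rsin u * (k == j)%:R + rcos u * (l == j)%:R else (i == j)%:R.
Proof. by rewrite -[givens]mulmx1 givens_mul !mxE. Qed.

Lemma SO_givens : SO givens.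
Proof.
have GG : givens *m givens^T = 1%:M.
  apply/matrixP => i j; rewrite givens_mul ![givens^T _ _]mxE [RHS]mxE !givensE.
  have := rcos2Drsin2 u; have lk : (l == k) = false by rewrite eq_sym (negbTE kl).
  have [ik|ik] := eqVneq i k; [|have [il|il] := eqVneq i l];
    (have [jk|jk] := eqVneq j k; [|have [jl|jl] := eqVneq j l]);
    rewrite ?ik ?il ?jk ?jl ?eqxx ?lk ?(negbTE kl) ?[k == j]eq_sym ?[l == j]eq_sym
      ?[k == i]eq_sym ?[l == i]eq_sym ?[j == i]eq_sym
      ?(negbTE ik) ?(negbTE il) ?(negbTE jk) ?(negbTE jl) //= => E; nra.
split=> //; first exact: mulmx1C.
by rewrite !det_mulmx !det_shear_mx// ?mulr1// eq_sym.
Qed.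

Lemma sqfrob_givensB1 : sqfrob (givens - 1%:M) = 4 * (1 - rcos u).
Proof.
rewrite sqfrobB trmx1 mulmx1 (sqfrob_SO SO_givens) (sqfrob_SO (SO1 _ _)).
have -> : \tr givens = d%:R - 2 + 2 * rcos u.
  rewrite /mxtrace (bigD1 k)//= (bigD1 l)//=; last by rewrite eq_sym.
  rewrite !givensE !eqxx [l == k]eq_sym (negbTE kl) /=.
  rewrite (eq_bigr (fun=> 1)); last first.
    by move=> i /andP[ik il]; rewrite givensE (negbTE ik) (negbTE il) eqxx.
  rewrite (eq_bigl (fun i => i \in (~: [set k; l])%SET)); last first.
    by move=> i; rewrite finset.in_setC finset.in_set2 negb_or.
  rewrite sumr_const.
  have := cardsC [set k; l]%SET; rewrite cards2 kl card_ord /= => /(congr1 (fun m => m%:R : R)).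
  by rewrite natrD => <-; ring.
by ring.
Qed.

(** The matrix on the left is the aligned product after rotating [Z i], see
    [aligned_product_rotate]. The coefficient of the sine plays the role of the derivative in the
    information inequality. *)
Lemma skew_entry_givens (n : nat) (A : 'M[R]_d) :
  skew_entry (A *m givens^T + n%:R^-1 *: (1%:M - givens^T)) k l =
  rcos u * skew_entry A k l + rsin u * (A k k + A l l - 2 / n%:R).
Proof.
have E i j : (A *m givens^T) i j = (givens *m A^T) j i.
  by rewrite -[A *m _]trmxK trmx_mul trmxK mxE.
have lk : (l == k) = false by rewrite eq_sym (negbTE kl).
rewrite /skew_entry ![fun_of_matrix (_ + _) _ _]mxE ![fun_of_matrix (_ *: _) _ _]mxE.
rewrite ![fun_of_matrix (_ - _) _ _]mxE ![fun_of_matrix (- _) _ _]mxE !E !givens_mul.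
rewrite ![A^T _ _]mxE ![givens^T _ _]mxE ![1%:M _ _]mxE !givensE !eqxx lk (negbTE kl) /=.
ring.
Qed.

End givens.

Section rotated_product.
Context (R : realType) (n d : nat).
Hypothesis n0 : (0 < n)%N.

Definition rotate_at (G : 'M[R]_d) (i : 'I_n) (Z : 'I_n -> 'M[R]_d) : 'I_n -> 'M[R]_d :=
  fun j => if j == i then G *m Z j else Z j.

Lemma SOn_rotate_at G i Z : SO G -> SOn Z -> SOn (rotate_at G i Z).
Proof. by move=> hG hZ j; rewrite /rotate_at; case: eqP => // _; exact: SO_mul. Qed.

(** Besides the factor [G^T] coming from [Z i], the alignment itself changes, because [Z i] is one
    of its [n] summands; that is the term with weight [n%:R^-1]. *)
Lemma aligned_product_rotate (G : 'M[R]_d) i Zh Z : SO G -> SOn Zh -> SOn Z ->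
  aligned_product Zh (rotate_at G i Z) i =
  aligned_product Zh Z i *m G^T + n%:R^-1 *: (1%:M - G^T).
Proof.
move=> [GG _ _] hZh hZ; have [ZZ _ _] := hZ i; have [ZZh _ _] := hZh i.
rewrite /aligned_product; have -> : alignment Zh (rotate_at G i Z) =
    alignment Zh Z + n%:R^-1 *: ((Zh i)^T *m ((G - 1%:M) *m Z i)).
  rewrite /alignment -scalerDr; congr (_ *: _).
  rewrite (bigD1 i)//= [in RHS](bigD1 i)//= /rotate_at eqxx.
  rewrite (eq_bigr (fun j => (Zh j)^T *m Z j)); last by move=> j /negbTE ->.
  by rewrite addrAC -mulmxDr mulmxBl mul1mx addrCA subrr addr0.
rewrite /rotate_at eqxx trmx_mul mulmxDr mulmxDl.
congr (_ + _); first by rewrite !mulmxA.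
rewrite -scalemxAr -scalemxAl; congr (_ *: _).
rewrite !mulmxA ZZh mul1mx -[_ *m Z i *m _]mulmxA ZZ mulmx1.
by rewrite mulmxBl GG mul1mx.
Qed.

End rotated_product.

(** * Gram-Schmidt orthonormalisation *)

Section gram_schmidt.
Context (R : realType) (d : nat).
Implicit Types (X G : 'M[R]_d) (v : 'cV[R]_d).

Definition normsq v : R := \sum_a v a 0 ^+ 2.

(* [(normsq v)^(-1/2) v], and [0] when [v = 0] since [ln 0 = 0] *)
Definition normalize v : 'cV[R]_d := expR (- (ln (normsq v) / 2)) *: v.

(** Natural-number indices let the recursion of [gs_proj] run on [nat]; the zero column is a filler
    beyond [d]. *)
Definition nth_col X (j : nat) : 'cV[R]_d := if insub j is Some j' then col j' X else 0.

(* Projection on the orthogonal complement of the first [j] columns. *)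
Fixpoint gs_proj X (j : nat) : 'M[R]_d :=
  if j is j'.+1 then
    let q := normalize (gs_proj X j' *m nth_col X j') in gs_proj X j' - q *m q^T
  else 1%:M.

Definition gs_residual X (j : nat) : 'cV[R]_d := gs_proj X j *m nth_col X j.
Definition gs_col X (j : nat) : 'cV[R]_d := normalize (gs_residual X j).
Definition gram_schmidt X : 'M[R]_d := \matrix_(a, j) gs_col X j a 0.

Lemma gs_projS X j : gs_proj X j.+1 = gs_proj X j - gs_col X j *m (gs_col X j)^T.
Proof. by []. Qed.

Lemma normsqE v : (v^T *m v) 0 0 = normsq v.
Proof. by rewrite mxE; apply: eq_bigr => a _; rewrite mxE expr2. Qed.

Section equivariance.
Variables (X G : 'M[R]_d).
Hypothesis GG : G^T *m G = 1%:M.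

Lemma normalize_mul v : normalize (G *m v) = G *m normalize v.
Proof.
rewrite /normalize -scalemxAr; congr (expR (- (ln _ / 2)) *: _).
by rewrite -!normsqE trmx_mul mulmxA -[_ *m G^T *m G]mulmxA GG mulmx1.
Qed.

Lemma nth_col_mul j : nth_col (G *m X) j = G *m nth_col X j.
Proof.
rewrite /nth_col; case: insub => [j'|]; last by rewrite mulmx0.
by apply/matrixP => a b; rewrite !mxE; apply: eq_bigr => m _; rewrite mxE.
Qed.

Lemma gs_proj_mul j : gs_proj (G *m X) j = G *m gs_proj X j *m G^T.
Proof.
elim: j => [|j IH]; first by rewrite /= mulmx1 (mulmx1C GG).
rewrite !gs_projS /gs_col /gs_residual IH nth_col_mul mulmxBr mulmxBl.
rewrite -!mulmxA [G^T *m (G *m _)]mulmxA GG mul1mx normalize_mul.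
by rewrite trmx_mul !mulmxA.
Qed.

Lemma gs_col_mul j : gs_col (G *m X) j = G *m gs_col X j.
Proof.
rewrite /gs_col /gs_residual gs_proj_mul nth_col_mul -!mulmxA [G^T *m (G *m _)]mulmxA.
by rewrite GG mul1mx normalize_mul.
Qed.

(** Every step uses only norms and products that an orthogonal [G] respects, so degenerate [X] are
    covered as well. This carries the rotation invariance of Gaussian matrices over to the prior. *)
Lemma gram_schmidt_mul : gram_schmidt (G *m X) = G *m gram_schmidt X.
Proof.
apply/matrixP => a j; rewrite mxE gs_col_mul [LHS]mxE [RHS]mxE.
by apply: eq_bigr => m _; rewrite [gram_schmidt _ _ _]mxE.
Qed.

End equivariance.

Lemma normsq_normalize v : 0 < normsq v -> normsq (normalize v) = 1.
Proof.
move=> v0; set e := expR (- (ln (normsq v) / 2)).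
have ee : e * e * normsq v = 1.
  rewrite -[X in _ * X](lnK (x := normsq v)) ?posrE//.
  by rewrite -!expRD -[RHS]expR0; congr expR; field.
rewrite -[RHS]ee /normalize -/e /normsq mulr_sumr; apply: eq_bigr => a _.
by rewrite mxE; ring.
Qed.

Definition gs_regular X : Prop := forall j, (j < d)%N -> 0 < normsq (gs_residual X j).

Lemma gs_proj_sym X j : (gs_proj X j)^T = gs_proj X j.
Proof.
elim: j => [|j IH]; first by rewrite trmx1.
by rewrite gs_projS linearB/= IH trmx_mul trmxK.
Qed.

(** By induction: the new unit column lies in the range of the current projection, so subtracting
    its rank-one projection keeps idempotence and kills that column too. *)
Lemma gs_proj_orth X : gs_regular X -> forall j, (j <= d)%N ->
  gs_proj X j *m gs_proj X j = gs_proj X j /\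
  (forall i, (i < j)%N -> gs_proj X j *m gs_col X i = 0).
Proof.
move=> rX; elim=> [|j IH] jd; first by rewrite mul1mx; split.
have [PP Pq] := IH (ltnW jd).
have Pqj : gs_proj X j *m gs_col X j = gs_col X j.
  by rewrite /gs_col /normalize /gs_residual -scalemxAr mulmxA PP.
have qP : (gs_col X j)^T *m gs_proj X j = (gs_col X j)^T.
  by rewrite -[LHS]trmxK trmx_mul trmxK gs_proj_sym Pqj.
have qq : (gs_col X j)^T *m gs_col X j = 1%:M.
  by rewrite [LHS]mx11_scalar normsqE normsq_normalize ?rX.
have Sq : gs_proj X j.+1 *m gs_col X j = 0.
  by rewrite gs_projS mulmxBl Pqj -mulmxA qq mulmx1 subrr.
split.
  rewrite {1}gs_projS mulmxBl -mulmxA.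
  have -> : (gs_col X j)^T *m gs_proj X j.+1 = 0.
    by rewrite -[LHS]trmxK trmx_mul trmxK gs_proj_sym Sq trmx0.
  by rewrite mulmx0 subr0 gs_projS mulmxBr PP mulmxA Pqj.
move=> i; rewrite ltnS leq_eqVlt => /predU1P[->//|ij].
rewrite gs_projS mulmxBl Pq// sub0r -mulmxA.
have -> : (gs_col X j)^T *m gs_col X i = 0.
  by rewrite -qP -mulmxA Pq// mulmx0.
by rewrite mulmx0 oppr0.
Qed.

Lemma gram_schmidt_orth X : gs_regular X -> (gram_schmidt X)^T *m gram_schmidt X = 1%:M.
Proof.
move=> rX.
have qlt i j : (i < j)%N -> (j < d)%N -> (gs_col X i)^T *m gs_col X j = 0.
  move=> ij jd; have [_ /(_ _ ij) Pq] := gs_proj_orth rX (ltnW jd).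
  rewrite /gs_col /normalize /gs_residual -scalemxAr mulmxA.
  rewrite -[_^T *m gs_proj X j]trmxK trmx_mul trmxK gs_proj_sym.
  by rewrite -/(normalize _) -/(gs_residual X i) -/(gs_col X i) Pq trmx0 mul0mx scaler0.
have E i j : ((gram_schmidt X)^T *m gram_schmidt X) i j = ((gs_col X i)^T *m gs_col X j) 0 0.
  rewrite [LHS]mxE [RHS]mxE; apply: eq_bigr => a _.
  by rewrite ![_^T _ _]mxE ![gram_schmidt _ _ _]mxE.
have EC i j : ((gs_col X i)^T *m gs_col X j) 0 0 = ((gs_col X j)^T *m gs_col X i) 0 0.
  by rewrite -[in LHS](trmxK ((gs_col X i)^T *m _)) trmx_mul trmxK [LHS]mxE.
apply/matrixP => i j; rewrite E [RHS]mxE.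
have [ij|ji|/val_inj ->] := ltngtP i j.
- by rewrite qlt// mxE; case: eqP => // e; rewrite e ltnn in ij.
- by rewrite EC qlt// mxE; case: eqP => // e; rewrite e ltnn in ji.
- by rewrite eqxx normsqE normsq_normalize ?rX.
Qed.

End gram_schmidt.

Section gram_schmidt_rotation.
Context (R : realType) (d : nat).
Implicit Types (X G : 'M[R]_d).

Lemma gs_projSE X j a b :
  gs_proj X j.+1 a b = gs_proj X j a b - gs_col X j a 0 * gs_col X j b 0.
Proof.
rewrite gs_projS [LHS]mxE; congr (_ + _); rewrite [LHS]mxE; congr (- _).
by rewrite [LHS]mxE big_ord1; congr (_ * _); rewrite [LHS]mxE.
Qed.

Definition is_SO (A : 'M[R]_d) : bool :=
  [&& A *m A^T == 1%:M, A^T *m A == 1%:M & \det A == 1].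

Lemma is_SOP A : reflect (SO A) (is_SO A).
Proof.
by apply: (iffP and3P) => -[]; [move=> /eqP ? /eqP ? /eqP|move=> ? ? ?; split; apply/eqP].
Qed.

Lemma is_SO_gram_schmidt_mul G X : SO G ->
  is_SO (gram_schmidt (G *m X)) = is_SO (gram_schmidt X).
Proof.
move=> hG; have [_ GG _] := hG; rewrite gram_schmidt_mul//.
apply/is_SOP/is_SOP => [h|]; last exact: SO_mul.
by have := SO_mul (SO_tr hG) h; rewrite mulmxA GG mul1mx.
Qed.

(** Orthonormal columns force the determinant to be 1 or -1, so its sign decides. *)
Lemma is_SO_gs_regular X : gs_regular X -> 0 < \det (gram_schmidt X) ->
  is_SO (gram_schmidt X).
Proof.
move=> rX dX; have QQ := gram_schmidt_orth rX.
apply/is_SOP; split=> //; first exact: mulmx1C.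
have /eqP : \det (gram_schmidt X) ^+ 2 = 1.
  by rewrite expr2 -{1}det_tr -det_mulmx QQ det1.
by rewrite sqrf_eq1 => /orP[/eqP//|/eqP e]; rewrite e in dX; lra.
Qed.

Let nth_col_lt X j (jd : (j < d)%N) : nth_col X j = col (Ordinal jd) X.
Proof. by rewrite /nth_col insubT. Qed.

Let e_ (j : nat) : 'cV[R]_d := \col_a (a == j :> nat)%:R.

Let normsq_e j : (j < d)%N -> normsq (e_ j) = 1.
Proof.
move=> jd; rewrite /normsq (bigD1 (Ordinal jd))//= mxE eqxx expr1n big1 ?addr0// => a aj.
by rewrite mxE (_ : (a == j :> nat) = false) ?expr0n//; apply/negbTE; rewrite -val_eqE in aj.
Qed.

Let gs_at1 j : (j <= d)%N ->
  gs_proj 1%:M j = \matrix_(a, b) ((a == b) && (j <= a)%N)%:R :> 'M[R]_d /\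
  (forall i, (i < j)%N -> gs_residual 1%:M i = e_ i /\ gs_col 1%:M i = e_ i).
Proof.
elim: j => [_|j IH jd].
  by split=> //; apply/matrixP => a b; rewrite !mxE leq0n andbT.
have [Pj cj] := IH (ltnW jd).
have rj : gs_residual 1%:M j = e_ j.
  rewrite /gs_residual Pj (nth_col_lt _ jd); apply/matrixP => a b.
  rewrite mxE [RHS]mxE (bigD1 (Ordinal jd))//= big1 ?addr0; last first.
    by move=> m mj; rewrite !mxE (negbTE mj) mulr0.
  rewrite !mxE eqxx mulr1 -val_eqE /=.
  by case: (eqVneq (nat_of_ord a) j) => [->|//]; rewrite leqnn.
have qj : gs_col 1%:M j = e_ j.
  by rewrite /gs_col /normalize rj normsq_e// ln1 mul0r oppr0 expR0 scale1r.
split.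
  rewrite gs_projS qj Pj; apply/matrixP => a b; rewrite !mxE big_ord1 !mxE -val_eqE /=.
  case: (eqVneq (nat_of_ord a) b) => [->|ab] /=.
    by case: (ltngtP j b) => _; rewrite /= ?mulr1 ?mulr0 ?subr0 ?subrr.
  case: (eqVneq (nat_of_ord a) j) => [aj|_]; last by rewrite mul0r subr0.
  by rewrite mul1r -aj eq_sym (negbTE ab) subr0.
by move=> i; rewrite ltnS leq_eqVlt => /predU1P[->|/cj].
Qed.

Section continuity_at_1.
Variables (F : set_system 'M[R]_d).
Context {FF : Filter F}.
Hypothesis cvg_entry : forall a b, X a b @[X --> F] --> ((1%:M : 'M[R]_d) a b : R).

Let cv (f : 'M[R]_d -> R) : Prop := f X @[X --> F] --> f 1%:M.

Let cv_sum (I : Type) (r : seq I) (f : I -> 'M[R]_d -> R) :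
  (forall i, cv (f i)) -> cv (fun X => \sum_(i <- r) f i X).
Proof.
move=> cf; rewrite /cv.
elim: r => [|i r IH].
  by under eq_fun do rewrite big_nil; rewrite big_nil; exact: cvg_cst.
under eq_fun do rewrite big_cons.
by rewrite big_cons; apply: cvgD => //; exact: cf.
Qed.

Let cv_prod (I : Type) (r : seq I) (f : I -> 'M[R]_d -> R) :
  (forall i, cv (f i)) -> cv (fun X => \prod_(i <- r) f i X).
Proof.
move=> cf; rewrite /cv.
elim: r => [|i r IH].
  by under eq_fun do rewrite big_nil; rewrite big_nil; exact: cvg_cst.
under eq_fun do rewrite big_cons.
by rewrite big_cons; apply: cvgM => //; exact: cf.
Qed.

Let cv_ext (f g : 'M[R]_d -> R) : f =1 g -> cv f -> cv g.
Proof. by move=> /funext ->. Qed.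

Let cvM f g : cv f -> cv g -> cv (fun X => f X * g X).
Proof. by move=> cf cg; apply: cvgM. Qed.

Let cv_entry a b : cv (fun X => X a b).
Proof. exact: cvg_entry. Qed.

Let cv_gs j : (j <= d)%N ->
  (forall a b, cv (fun X => gs_proj X j a b)) /\
  (forall i, (i < j)%N -> (forall a, cv (fun X => gs_residual X i a 0)) /\
                          (forall a, cv (fun X => gs_col X i a 0))).
Proof.
elim: j => [_|j IH jd].
  by split=> // a b; exact: cvg_cst.
have [Pj cj] := IH (ltnW jd).
have rj a : cv (fun X => gs_residual X j a 0).
  apply: (@cv_ext (fun X => \sum_m gs_proj X j a m * X m (Ordinal jd))).
    move=> X; rewrite /gs_residual (nth_col_lt _ jd) mxE.
    by apply: eq_bigr => m _; rewrite [in RHS]mxE.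
  by apply: cv_sum => m; exact: cvM.
have nj : cv (fun X => normsq (gs_residual X j)).
  by apply: cv_sum => a; exact: (cvM (rj a) (rj a)).
have qj a : cv (fun X => gs_col X j a 0).
  apply: (@cv_ext (fun X => expR (- (ln (normsq (gs_residual X j)) / 2)) * gs_residual X j a 0)).
    by move=> X; rewrite [RHS]mxE.
  apply: cvM => //; rewrite /cv.
  apply: (cvg_comp _ expR); last exact: continuous_expR.
  apply: cvgN; apply: cvgM; last exact: cvg_cst.
  (* [ln] is continuous only at positive points; the residual at the identity is a unit vector. *)
  apply: (cvg_comp _ (@ln R) nj); apply: continuous_ln.
  have [_ /(_ _ (ltnSn j)) [-> _]] := gs_at1 jd.
  by rewrite normsq_e.
split=> [a b|i].
  apply: (@cv_ext (fun X => gs_proj X j a b - gs_col X j a 0 * gs_col X j b 0)).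
    by move=> X; rewrite gs_projSE.
  by apply: cvgB; [exact: Pj|exact: cvM].
by rewrite ltnS leq_eqVlt => /predU1P[->|/cj].
Qed.

Let gt0_near (f : 'M[R]_d -> R) : cv f -> 0 < f 1%:M -> \forall X \near F, 0 < f X.
Proof. by move=> cf f0; exact: (cvgr_gt _ cf). Qed.

(** Positive residual norms and a positive determinant persist nearby. Both hold at the identity,
    which Gram-Schmidt fixes and where all its entries are continuous. *)
Lemma gram_schmidt_near : \forall X \near F, is_SO (gram_schmidt X).
Proof.
have [_ at1] := gs_at1 (leqnn d); have [_ cvd] := cv_gs (leqnn d).
have cQ a j : cv (fun X => gram_schmidt X a j).
  apply: (@cv_ext (fun X => gs_col X j a 0)); last exact: (cvd _ (ltn_ord _)).2.
  by move=> X; rewrite [RHS]mxE.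
have cdet : cv (fun X => \det (gram_schmidt X)).
  rewrite /determinant; apply: cv_sum => s; apply: cvM; first exact: cvg_cst.
  by apply: cv_prod => i; exact: cQ.
have det_1 : \det (gram_schmidt (1%:M : 'M[R]_d)) = 1.
  rewrite (_ : gram_schmidt _ = 1%:M) ?det1//; apply/matrixP => a j.
  by rewrite [LHS]mxE (at1 _ (ltn_ord j)).2 !mxE val_eqE.
have nres : \forall X \near F, forall j : 'I_d, 0 < normsq (gs_residual X j).
  apply: filter_forall => j; apply: (gt0_near (f := fun X => normsq (gs_residual X j))).
    by apply: cv_sum => a; apply: cvM; exact: (cvd _ (ltn_ord _)).1.
  by rewrite (at1 _ (ltn_ord j)).1 normsq_e.
have ndet : \forall X \near F, 0 < \det (gram_schmidt X).
  by apply: gt0_near => //; rewrite det_1.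
near=> X; apply: is_SO_gs_regular; last by near: X.
move=> j jd; have : forall j : 'I_d, 0 < normsq (gs_residual X j) by near: X.
by move=> /(_ (Ordinal jd)).
Unshelve. all: by end_near. Qed.

End continuity_at_1.

Lemma gram_schmidt_near1 : exists2 e : R, 0 < e &
  forall X, (forall a b, `|X a b - (a == b)%:R| < e) -> is_SO (gram_schmidt X).
Proof.
have H : nbhs (1%:M : 'M[R]_d) [set X | is_SO (gram_schmidt X)].
  apply: (@gram_schmidt_near (nbhs (1%:M : 'M[R]_d))) => a b.
  exact: coord_continuous.
have [e /= e0 He] := (nbhs_ballP _ _).1 H.
exists e => // X Xe; apply: He; split=> // a b.
by rewrite mxE /ball /= distrC; exact: Xe.
Qed.

End gram_schmidt_rotation.

(** * Measurability of Gram-Schmidt and of matrix operations *)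

Section gram_schmidt_measurable.
Context (R : realType) (d : nat) disp (T : measurableType disp) (f : T -> 'M[R]_d).
Hypothesis mf : forall a b, measurable_fun setT (fun x => f x a b).

Let measurable_nth_col j a : measurable_fun setT (fun x => nth_col (f x) j a 0).
Proof.
rewrite /nth_col; case: insub => [j'|]; last first.
  by under eq_fun do rewrite mxE; exact: measurable_cst.
by under eq_fun do rewrite mxE; exact: mf.
Qed.

Let measurable_gs j :
  (forall a b, measurable_fun setT (fun x => gs_proj (f x) j a b)) /\
  (forall a, measurable_fun setT (fun x => gs_col (f x) j a 0)).
Proof.
have col_ j' : (forall a b, measurable_fun setT (fun x => gs_proj (f x) j' a b)) ->
    forall a, measurable_fun setT (fun x => gs_col (f x) j' a 0).
  move=> mP.
  have mr a : measurable_fun setT (fun x => gs_residual (f x) j' a 0).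
    under eq_fun do rewrite mxE.
    by apply: measurable_sum => m; apply: measurable_funM.
  move=> a; under eq_fun do rewrite mxE.
  apply: measurable_funM => //; apply: measurableT_comp => //; apply: measurable_funN.
  apply: measurable_funM => //; apply: (measurableT_comp (@measurable_ln R)).
  by apply: measurable_sum => b; exact: measurable_funX.
suff mP : forall a b, measurable_fun setT (fun x => gs_proj (f x) j a b).
  by split=> //; exact: col_.
elim: j => [|j IH] a b; first exact: measurable_cst.
rewrite (_ : (fun x => _) =
    (fun x => gs_proj (f x) j a b - gs_col (f x) j a 0 * gs_col (f x) j b 0)).
  by apply: measurable_funB => //; apply: measurable_funM; exact: col_.
by apply/funext => x; rewrite gs_projSE.
Qed.

Lemma measurable_gram_schmidt a b :
  measurable_fun setT (fun x => gram_schmidt (f x) a b).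
Proof. by under eq_fun do rewrite mxE; exact: (measurable_gs b).2. Qed.

End gram_schmidt_measurable.

Section measurable_matrix.
Context (R : realType) (d : nat) disp (T : measurableType disp).
Implicit Types f g : T -> 'M[R]_d.

Definition mx_measurable f := forall a b, measurable_fun setT (fun x => f x a b).

Lemma measurable_mulmx f g : mx_measurable f -> mx_measurable g ->
  mx_measurable (fun x => f x *m g x).
Proof.
move=> mf mg a b; under eq_fun do rewrite mxE.
by apply: measurable_sum => m; exact: measurable_funM.
Qed.

Lemma measurable_trmx f : mx_measurable f -> mx_measurable (fun x => (f x)^T).
Proof. by move=> mf a b; under eq_fun do rewrite mxE; exact: mf. Qed.

Lemma measurable_det f : mx_measurable f -> measurable_fun setT (fun x => \det (f x)).
Proof.
move=> mf; rewrite /determinant; apply: measurable_sum => s; apply: measurable_funM => //.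
exact: measurable_prod.
Qed.

Lemma measurable_big_andb (I : Type) (r : seq I) (h : I -> T -> bool) :
  (forall i, measurable_fun setT (h i)) ->
  measurable_fun setT (fun x => \big[andb/true]_(i <- r) h i x).
Proof.
move=> mh; elim: r => [|i r IH].
  by under eq_fun do rewrite big_nil; exact: measurable_cst.
by under eq_fun do rewrite big_cons; exact: measurable_and.
Qed.

Lemma measurable_eq_mx f (B : 'M[R]_d) : mx_measurable f ->
  measurable_fun setT (fun x => f x == B).
Proof.
move=> mf; rewrite (_ : (fun x => _) =
    (fun x => \big[andb/true]_a \big[andb/true]_b (f x a b == B a b))).
  by do 2 (apply: measurable_big_andb => ?); exact: measurable_fun_eqr.
apply/funext => x; rewrite big_andE; apply/eqP/forallP => [-> a|E].
  by rewrite big_andE; apply/forallP => b; exact: eqxx.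
by apply/matrixP => a b; have := E a; rewrite big_andE => /forallP/(_ b)/eqP.
Qed.

Lemma measurable_is_SO f : mx_measurable f -> measurable_fun setT (fun x => is_SO (f x)).
Proof.
move=> mf; have mfT := measurable_trmx mf.
apply: measurable_and; first by apply: measurable_eq_mx; exact: measurable_mulmx.
apply: measurable_and; first by apply: measurable_eq_mx; exact: measurable_mulmx.
by apply: measurable_fun_eqr => //; exact: measurable_det.
Qed.

End measurable_matrix.

(** * The model on independent coordinates *)

Section coordinates_of_the_model.
Context (R : realType) (n d : nat).

(* Gaussian matrices generating the prior, then the indicators and the noise of the data. *)
Definition model_index : finType :=
  (('I_n * ('I_d * 'I_d)) + (edge n + edge n * ('I_d * 'I_d)))%type.

Definition prior_ix (i : 'I_n) (a b : 'I_d) : model_index := inl (i, (a, b)).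
Definition edge_ix (e : edge n) : model_index := inr (inl e).
Definition noise_ix (e : edge n) (a b : 'I_d) : model_index := inr (inr (e, (a, b))).
Definition is_noise (j : model_index) : bool := if j is inr (inr _) then true else false.

Implicit Types z : coords R model_index.

Definition prior_mx z (i : 'I_n) : 'M[R]_d := \matrix_(a, b) z (prior_ix i a b).
Definition prior z (i : 'I_n) : 'M[R]_d := gram_schmidt (prior_mx z i).
Definition good z : bool := [forall i, is_SO (prior z i)].
Definition present (e : edge n) z : bool := z (edge_ix e) == 1.
Definition noise_mx z (e : edge n) : 'M[R]_d := \matrix_(a, b) z (noise_ix e a b).

Definition mean (Z : 'I_n -> 'M[R]_d) (e : edge n) : 'M[R]_d :=
  Z (val e).1 *m (Z (val e).2)^T.

(** The parameter [Z] is separate from [z], so that the noise in [z] can also be combined with a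
    rotated parameter. *)
Definition sample (sigma : R) (Z : 'I_n -> 'M[R]_d) z : data R n d :=
  fun e => if present e z then Some (mean Z e + sigma *: noise_mx z e) else None.

Lemma good_SOn z : good z -> SOn (prior z).
Proof. by move=> /forallP h i; exact/is_SOP. Qed.

Lemma measurable_prior i : mx_measurable (fun z => prior z i).
Proof.
move=> a b; apply: measurable_gram_schmidt => a' b'.
rewrite (_ : (fun z => _) = coord (prior_ix i a' b')); first exact: measurable_coord.
by apply: funext => z; rewrite mxE.
Qed.

Lemma measurable_good : measurable_fun setT good.
Proof.
rewrite (_ : good = fun z => \big[andb/true]_i is_SO (prior z i)).
  by apply: measurable_big_andb => i; apply: measurable_is_SO; exact: measurable_prior.
by apply/funext => z; rewrite big_andE.
Qed.

Lemma measurable_present e : measurable_fun setT (present e).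
Proof. by apply: measurable_fun_eqr => //; exact: measurable_coord. Qed.

Lemma measurable_mean (Z : coords R model_index -> 'I_n -> 'M[R]_d) e :
  (forall i, mx_measurable (fun z => Z z i)) -> mx_measurable (fun z => mean (Z z) e).
Proof. by move=> mZ; apply: measurable_mulmx => //; exact: measurable_trmx. Qed.

Lemma measurable_sample (sigma : R) (Z : coords R model_index -> 'I_n -> 'M[R]_d) :
  (forall i, mx_measurable (fun z => Z z i)) ->
  measurable_fun setT
    (fun z => sample sigma (Z z) z : g_sigma_algebraType (@data_cylinders R n d)).
Proof.
move=> mZ; apply: (@measurability _ _ (coords R model_index)
  (g_sigma_algebraType (@data_cylinders R n d)) setT _ (@data_cylinders R n d)) => //.
move=> _ [_ [[e _ [Y mY <-]]|[[e [a b]] _ [Y mY <-]]] <-]; rewrite !setTI.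
  rewrite (_ : _ @^-1` _ = present e @^-1` Y).
    by rewrite -[X in measurable X]setTI; exact: measurable_present.
  by apply/seteqP; split => z; rewrite /preimage /= /observed /sample; case: (present e z).
rewrite (_ : _ @^-1` _ = (fun z => if present e z then
    mean (Z z) e a b + sigma * z (noise_ix e a b) else 0) @^-1` Y).
  rewrite -[X in measurable X]setTI; suff : measurable_fun setT (fun z : coords R model_index =>
    if present e z then mean (Z z) e a b + sigma * z (noise_ix e a b) else 0) by exact.
  apply: measurable_fun_ifT => //; first exact: measurable_present.
  apply: measurable_funD; first exact: measurable_mean.
  by apply: measurable_funM => //; exact: measurable_coord.
apply/seteqP; split => z; rewrite /preimage /= /entry /sample; case: (present e z) => //;
  by rewrite !mxE.
Qed.

Section rotation_of_the_prior.
Variables (u : R) (i : 'I_n) (k l : 'I_d).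
Hypothesis kl : k != l.

(** Left multiplication by a Givens rotation mixes rows [k] and [l], hence acts as one plane
    rotation for every column [m]. *)
Definition prior_planes (s : seq 'I_d) : seq (model_index * model_index) :=
  [seq (prior_ix i k m, prior_ix i l m) | m <- s].

Definition rotate_prior z : coords R model_index :=
  plane_rotations u (prior_planes (enum 'I_d)) z.

Lemma prior_ix_eq i1 a1 b1 i2 a2 b2 :
  (prior_ix i1 a1 b1 == prior_ix i2 a2 b2) = [&& i1 == i2, a1 == a2 & b1 == b2].
Proof. by []. Qed.

Let rotations_off s z j : (forall m, (j != prior_ix i k m) && (j != prior_ix i l m)) ->
  plane_rotations u (prior_planes s) z j = z j.
Proof.
move=> hj; elim: s => [//|m s IH] /=; rewrite /plane_rotation /=.
by have /andP[/negbTE -> /negbTE ->] := hj m.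
Qed.

Let rotations_on s z m : uniq s ->
  plane_rotations u (prior_planes s) z (prior_ix i k m) =
    (if m \in s then rcos u * z (prior_ix i k m) - rsin u * z (prior_ix i l m)
     else z (prior_ix i k m)) /\
  plane_rotations u (prior_planes s) z (prior_ix i l m) =
    (if m \in s then rsin u * z (prior_ix i k m) + rcos u * z (prior_ix i l m)
     else z (prior_ix i l m)).
Proof.
have lk : (l == k) = false by rewrite eq_sym (negbTE kl).
elim: s => [//|m' s IH] /= /andP[ms us]; have [IH1 IH2] := IH us.
rewrite /plane_rotation /= !prior_ix_eq !eqxx (negbTE kl) lk /= in_cons.
by case: (eqVneq m m') => [e|//]; rewrite /= -e IH1 IH2 e (negbTE ms).
Qed.

Lemma prior_mx_rotate z j :
  prior_mx (rotate_prior z) j =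
  if j == i then givens u k l *m prior_mx z i else prior_mx z j.
Proof.
case: (eqVneq j i) => [->|ji]; apply/matrixP => a b; last first.
  rewrite !mxE; apply: rotations_off => m.
  by rewrite !prior_ix_eq (negbTE ji).
rewrite givens_mul// !mxE /rotate_prior.
have [E1 E2] := rotations_on z b (enum_uniq 'I_d).
rewrite mem_enum /= in E1 E2.
case: (eqVneq a k) => [->//|ak]; case: (eqVneq a l) => [->//|al].
by apply: rotations_off => m; rewrite !prior_ix_eq eqxx (negbTE ak) (negbTE al).
Qed.

Lemma prior_rotate z : prior (rotate_prior z) = rotate_at (givens u k l) i (prior z).
Proof.
have [_ GG _] := SO_givens u kl.
apply/funext => j; rewrite /prior prior_mx_rotate /rotate_at.
by case: eqP => [->|//]; rewrite gram_schmidt_mul.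
Qed.

Lemma good_rotate z : good (rotate_prior z) = good z.
Proof.
apply: eq_forallb => j; rewrite /prior prior_mx_rotate.
by case: eqP => [->|//]; rewrite is_SO_gram_schmidt_mul//; exact: SO_givens.
Qed.

Lemma rotate_prior_other z j : (if j is inr _ then true else false) -> rotate_prior z j = z j.
Proof. by case: j => // j _; apply: rotations_off. Qed.

Lemma sample_rotate sigma Z z : sample sigma Z (rotate_prior z) = sample sigma Z z.
Proof.
apply/funext => e; rewrite /sample /present rotate_prior_other//.
case: ifP => // _; congr (Some (_ + _ *: _)); apply/matrixP => a b.
by rewrite !mxE rotate_prior_other.
Qed.

End rotation_of_the_prior.
End coordinates_of_the_model.

(** * Noise shift equivalent to a rotation of one parameter *)

Section likelihood_ratio.
Context (R : realType) (n d : nat) (p sigma : R).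
Variable mu : probability (coords R (model_index n d)) R.
Hypothesis imu : independent_coords mu.
Hypothesis gaussian_prior : forall i a b, gaussian_coord mu (prior_ix i a b).
Hypothesis gaussian_noise : forall e a b, gaussian_coord mu (noise_ix e a b).
Hypothesis present_prob : forall e : edge n, mu [set z | present (d := d) e z] = p%:E.
Hypotheses (p01 : 0 < p <= 1) (sigma0 : 0 < sigma).
Variables (u : R) (i : 'I_n) (k l : 'I_d).
Hypothesis kl : k != l.
Implicit Types z : coords R (model_index n d).

Let G := givens u k l.
Let rotated z := rotate_at G i (prior z).
Let shiftee : seq (model_index n d) := [seq j <- enum (model_index n d) | is_noise j].

Definition mean_shift z (e : edge n) : 'M[R]_d :=
  sigma^-1 *: (mean (rotate_at (givens u k l) i (prior z)) e - mean (prior z) e).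

(** Noise of unobserved pairs is left in place: it does not enter the data, and shifting it would
    add spurious information. This is how [p] enters the chi-square bound. *)
Definition noise_shift (j : model_index n d) z : R :=
  match j with
  | inr (inr (e, (a, b))) => (present e z)%:R * mean_shift z e a b
  | _ => 0
  end.

Lemma mean_shiftE z e a b : mean_shift z e a b = sigma^-1 *
  (mean (rotate_at (givens u k l) i (prior z)) e a b - mean (prior z) e a b).
Proof. by rewrite [LHS]mxE; congr (_ * _); rewrite [LHS]mxE; congr (_ + _); rewrite [LHS]mxE. Qed.

Lemma prior_off z z' : (forall j, ~~ is_noise j -> z j = z' j) -> prior z = prior z'.
Proof.
move=> zz'; apply/funext => j; congr gram_schmidt.
by apply/matrixP => a b; rewrite !mxE zz'.
Qed.

Lemma good_off z z' : (forall j, ~~ is_noise j -> z j = z' j) -> good z = good z'.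
Proof. by move=> /prior_off zz'; rewrite /good zz'. Qed.

Lemma present_off e z z' : (forall j, ~~ is_noise j -> z j = z' j) ->
  present e z = present e z'.
Proof. by move=> zz'; rewrite /present zz'. Qed.

Lemma noise_shift_off j z z' : (forall j, ~~ is_noise j -> z j = z' j) ->
  noise_shift j z = noise_shift j z'.
Proof.
move=> zz'; case: j => [//|[//|[e [a b]]]] /=.
by rewrite (present_off e zz') /mean_shift (prior_off zz').
Qed.

Lemma measurable_rotated j : mx_measurable (fun z => rotate_at (givens u k l) i (prior z) j).
Proof.
rewrite /rotate_at; case: (j == i); last exact: measurable_prior.
apply: measurable_mulmx; last exact: measurable_prior.
by move=> a b; exact: measurable_cst.
Qed.

Lemma measurable_natr_bool disp (T : measurableType disp) (b : T -> bool) :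
  measurable_fun setT b -> measurable_fun setT (fun x => (b x)%:R : R).
Proof.
move=> mb; rewrite (_ : (fun x => _) = (fun x => if b x then 1 else 0)).
  exact: measurable_fun_ifT.
by apply/funext => x; case: (b x).
Qed.

Lemma measurable_noise_shift j : measurable_fun setT (noise_shift j).
Proof.
case: j => [?|[?|[e [a b]]]] /=; try exact: measurable_cst.
apply: measurable_funM; first by apply: measurable_natr_bool; exact: measurable_present.
rewrite (_ : (fun z => _) = (fun z => sigma^-1 *
  (mean (rotate_at (givens u k l) i (prior z)) e a b - mean (prior z) e a b))).
  apply: measurable_funM => //; apply: measurable_funB; apply: measurable_mean.
    exact: measurable_rotated.
  exact: measurable_prior.
by apply: funext => z; rewrite mean_shiftE.
Qed.

Lemma shift_noise_off z j : ~~ is_noise j -> shift_coords shiftee noise_shift z j = z j.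
Proof. by move=> /negbTE jn; rewrite /shift_coords mem_filter jn. Qed.

Lemma sample_shift z : sample sigma (prior z) (shift_coords shiftee noise_shift z) =
  sample sigma (rotated z) z.
Proof.
apply/funext => e; rewrite /sample (present_off e (shift_noise_off z)).
case: (boolP (present e z)) => // pe; congr Some; apply/matrixP => a b.
rewrite [LHS]mxE [RHS]mxE ![fun_of_matrix (sigma *: _) _ _]mxE ![noise_mx _ _ _ _]mxE.
rewrite /shift_coords mem_filter mem_enum /= pe mul1r mean_shiftE mulrDr.
by rewrite mulrA divff ?gt_eqF// mul1r; ring.
Qed.

Lemma sum_noise_shift z : \sum_(j <- shiftee) noise_shift j z ^+ 2 =
  \sum_(e : edge n) (present e z)%:R * sqfrob (mean_shift z e).
Proof.
rewrite /shiftee big_filter big_enum_cond/= big_sumType/= big_pred0_eq add0r.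
rewrite big_sumType/= big_pred0_eq add0r.
transitivity (\sum_(e : edge n) \sum_(a < d) \sum_(b < d)
    noise_shift (inr (inr (e, (a, b)))) z ^+ 2).
  under [RHS]eq_bigr do rewrite pair_bigA.
  by rewrite pair_bigA; apply: eq_bigr => -[e [a b]].
apply: eq_bigr => e _; rewrite mulr_sumr; apply: eq_bigr => a _.
rewrite mulr_sumr; apply: eq_bigr => b _ /=.
by case: (present e z); rewrite ?mul1r ?mul0r ?expr0n.
Qed.

Definition incident (e : edge n) : bool := ((val e).1 == i) || ((val e).2 == i).

Let info : R := 4 * (1 - rcos u) / sigma ^+ 2.

(** Only pairs containing [i] change. There the difference of means is [G - 1%:M] or its transpose
    times an orthogonal matrix, so its norm is that of [G - 1%:M]. *)
Lemma sqfrob_mean_shift z e : good z -> sqfrob (mean_shift z e) = (incident e)%:R * info.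
Proof.
move=> /good_SOn hZ; set Z := prior z in hZ *.
have -> : sqfrob (mean_shift z e) = sigma ^- 2 * sqfrob (mean (rotate_at G i Z) e - mean Z e).
  by rewrite /sqfrob !mulr_sumr; apply: eq_bigr => a _; rewrite mulr_sumr;
    apply: eq_bigr => b _; rewrite [in LHS]mxE exprMn exprVn.
rewrite mulrC; suff -> : sqfrob (mean (rotate_at G i Z) e - mean Z e) =
    (incident e)%:R * (4 * (1 - rcos u)) by rewrite /info !mulrA.
rewrite /mean /incident /rotate_at -(sqfrob_givensB1 u kl).
have e12 : (val e).1 != (val e).2 by rewrite neq_ltn (valP e).
have [e1|e1] := eqVneq (val e).1 i; have [e2|e2] := eqVneq (val e).2 i => /=.
- by rewrite e1 e2 eqxx in e12.
- rewrite mul1r e1 (_ : G *m Z i *m _ - _ = (G - 1%:M) *m (Z i *m (Z (val e).2)^T)).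
    by rewrite sqfrob_orthr//; have [] := SO_mul (hZ i) (SO_tr (hZ (val e).2)).
  by rewrite mulmxBl mul1mx mulmxA.
- rewrite mul1r e2 trmx_mul mulmxA (_ : _ - _ = Z (val e).1 *m (Z i)^T *m (G - 1%:M)^T).
    rewrite sqfrob_orthl ?sqfrobT//.
    by have [] := SO_mul (hZ (val e).1) (SO_tr (hZ i)).
  by rewrite raddfB /= trmx1 mulmxBr mulmx1.
- by rewrite subrr mul0r /sqfrob big1// => a _; rewrite big1// => b _; rewrite mxE expr0n.
Qed.

(** A pair containing [i] is determined by its other endpoint. Bounding by [n] makes the information
    per matrix a multiple of [n p / sigma^2]. *)
Lemma card_incident : (#|[pred e | incident e]| <= n)%N.
Proof.
pose other (e : edge n) := if (val e).1 == i then (val e).2 else (val e).1.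
rewrite -[leqRHS]card_ord; apply: (@leq_card_in _ _ other).
move=> [[a b] /= ab] [[a' b'] /= ab']; rewrite !inE /incident /other /= => h h' e.
apply: val_inj => /=; move: h h' e ab ab'.
have [->|ai] := eqVneq a i; have [->|ai'] := eqVneq a' i => //=.
- by move=> _ _ ->.
- by move=> _ /eqP -> -> h h'; have := ltn_trans h h'; rewrite ltnn.
- by move=> /eqP -> _ -> h h'; have := ltn_trans h h'; rewrite ltnn.
- by move=> /eqP -> /eqP -> ->.
Qed.

End likelihood_ratio.

(** * The information inequality *)

Section bounds_and_measurability.
Context (R : realType) (n d : nat).
Hypothesis n0 : (0 < n)%N.
Implicit Types Zh Z : 'I_n -> 'M[R]_d.

Lemma misalignment_ge0 Zh Z : SOn Zh -> SOn Z -> 0 <= misalignment Zh Z.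
Proof.
move=> hZh hZ; have n0R : 0 < n%:R :> R by rewrite ltr0n.
rewrite -(pmulr_rge0 _ n0R) -sum_sqfrob_aligned//.
by apply: sumr_ge0 => i _; exact: sqfrob_ge0.
Qed.

Lemma aligned_product_le Zh Z i a b : SOn Zh -> SOn Z ->
  `|aligned_product Zh Z i a b| <= d%:R.
Proof.
move=> hZh hZ; have [_ ZZh _] := hZh i; have [_ ZZ _] := hZ i.
have E : sqfrob (aligned_product Zh Z i) <= d%:R.
  rewrite /aligned_product sqfrob_orthr ?trmxK// sqfrob_orthl//.
  by have := misalignment_ge0 hZh hZ; rewrite subr_ge0.
rewrite -(@ler_pXn2r _ 2)// ?nnegrE ?ler0n// real_normK ?num_real//.
apply: (@le_trans _ _ d%:R); last first.
  by rewrite -natrX ler_nat; case: (d) => // m; rewrite expnS leq_pmulr// expn_gt0.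
apply: le_trans E; rewrite /sqfrob (bigD1 a)//= (bigD1 b)//= -addrA lerDl.
apply: addr_ge0; first by apply: sumr_ge0 => ? _; exact: sqr_ge0.
by do 2 (apply: sumr_ge0 => ? _); exact: sqr_ge0.
Qed.

Context disp (T : measurableType disp).
Variables (f g : T -> 'I_n -> 'M[R]_d).
Hypothesis mf : forall i, mx_measurable (fun x => f x i).
Hypothesis mg : forall i, mx_measurable (fun x => g x i).

Lemma measurable_alignment : mx_measurable (fun x => alignment (f x) (g x)).
Proof.
move=> a b; rewrite (_ : (fun x => _) =
    (fun x => n%:R^-1 * \sum_(j < n) ((f x j)^T *m g x j) a b)); last first.
  by apply/funext => x; rewrite [LHS]mxE summxE.
apply: measurable_funM => //; apply: measurable_sum => j.
by apply: measurable_mulmx => //; exact: measurable_trmx.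
Qed.

Lemma measurable_aligned_product i :
  mx_measurable (fun x => aligned_product (f x) (g x) i).
Proof.
apply: measurable_mulmx; last exact: measurable_trmx.
by apply: measurable_mulmx => //; exact: measurable_alignment.
Qed.

Lemma measurable_misalignment : measurable_fun setT (fun x => misalignment (f x) (g x)).
Proof.
apply: measurable_funB => //; do 2 (apply: measurable_sum => ?).
by apply: measurable_funX; exact: measurable_alignment.
Qed.

End bounds_and_measurability.

(** From [expR (- y) >= 1 - y] one gets [expR y <= 1 / (1 - y)], and [(1 - y) (1 + y + 2 y^2) = 1 +
    y^2 (1 - 2 y)] is at least 1 on this range. *)
Lemma expR_le_quadratic (R : realType) (y : R) : 0 <= y <= 2^-1 ->
  expR y <= 1 + y + 2 * y ^+ 2.
Proof.
move=> /andP[y0 y1]; have h : 1 - y <= expR (- y) by exact: expR_ge1Dx.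
have hy : 0 < 1 - y by lra.
have : expR y * (1 - y) <= 1.
  by rewrite -[leRHS](expRxMexpNx_1 y) ler_pM2l// expR_gt0.
rewrite -ler_pdivlMr// div1r => /le_trans; apply.
by rewrite -div1r ler_pdivrMr//; nra.
Qed.

Section expectation_of_sums.
Context disp (T : measurableType disp) (R : realType) (mu : probability T R).

Lemma Rintegral_sum (I : Type) (r : seq I) (P : pred I) (f : I -> T -> R) :
  (forall e, intble mu (f e)) ->
  intble mu (fun z => \sum_(e <- r | P e) f e z) /\
  \int[mu]_z \sum_(e <- r | P e) f e z = \sum_(e <- r | P e) \int[mu]_z f e z.
Proof.
move=> fi; elim: r => [|e r [IH1 IH2]].
  rewrite big_nil; split.
    rewrite (_ : (fun z => _) = (fun=> 0)); last by apply/funext => z; rewrite big_nil.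
    by apply: (@bounded_intble _ _ _ mu _ 0) => // z; rewrite normr0.
  under eq_Rintegral do rewrite big_nil.
  by rewrite Rintegral_cst// mul0r.
split.
  rewrite (_ : (fun z => _) = (fun z => (if P e then f e z else 0) + \sum_(e <- r | P e) f e z)).
    apply: intbleD => //; case: (P e) => //.
    by apply: (@bounded_intble _ _ _ mu _ 0) => // z; rewrite normr0.
  by apply: funext => z; rewrite big_cons; case: (P e) => //; rewrite add0r.
under eq_Rintegral do rewrite big_cons.
rewrite big_cons; case: (P e) => //; rewrite -IH2.
exact: (RintegralD measurableT (fi e) IH1).
Qed.

End expectation_of_sums.

Section information.
Context (R : realType) (n d : nat) (p sigma : R).
Variable mu : probability (coords R (model_index n d)) R.
Hypothesis imu : independent_coords mu.
Hypothesis gaussian_prior : forall i a b, gaussian_coord mu (prior_ix i a b).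
Hypothesis gaussian_noise : forall e a b, gaussian_coord mu (noise_ix e a b).
Hypothesis present_prob : forall e : edge n, mu [set z | present (d := d) e z] = p%:E.
Hypotheses (p01 : 0 < p <= 1) (sigma0 : 0 < sigma) (n0 : (0 < n)%N).
Variable (Zh : data R n d -> 'I_n -> 'M[R]_d).
Hypothesis hZh : estimator Zh.
Implicit Types z : coords R (model_index n d).

(** Conditioning on [good] without renormalising: the mass [good_mass] is carried along and
    cancelled only in the final theorem. *)
Definition on_good (f : coords R (model_index n d) -> R) z : R := if good z then f z else 0.

Definition estimate z : 'I_n -> 'M[R]_d := Zh (sample sigma (prior z) z).

Lemma measurable_estimate j : mx_measurable (fun z => estimate z j).
Proof.
move=> a b; have [_ mZh] := hZh.
exact: (measurableT_comp (mZh j a b) (measurable_sample sigma (@measurable_prior R n d))).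
Qed.

Lemma SOn_estimate z : SOn (estimate z).
Proof. by have [h _] := hZh; exact: h. Qed.

Lemma measurable_on_good f : measurable_fun setT f -> measurable_fun setT (on_good f).
Proof. by move=> mf; apply: measurable_fun_ifT => //; exact: measurable_good. Qed.

Lemma on_good_le f (K : R) : 0 <= K -> (forall z, good z -> `|f z| <= K) ->
  forall z, `|on_good f z| <= K.
Proof. by move=> K0 fK z; rewrite /on_good; case: ifPn => [/fK//|_]; rewrite normr0. Qed.

Definition good_mass : R := \int[mu]_z (good z)%:R.

Lemma measurable_goodR : measurable_fun setT (fun z => (good z)%:R : R).
Proof. apply: measurable_natr_bool; exact: measurable_good. Qed.

Lemma measurable_presentR e : measurable_fun setT (fun z => (present e z)%:R : R).
Proof. apply: measurable_natr_bool; exact: measurable_present. Qed.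

Lemma intble_good : intble mu (fun z => (good z)%:R : R).
Proof.
apply: (@bounded_intble _ _ _ mu _ 1); first exact: measurable_goodR.
by move=> z; rewrite normr_nat lern1 leq_b1.
Qed.

Lemma intble_present_good e :
  intble mu (fun z => (present (d := d) e z)%:R * (good z)%:R : R).
Proof.
apply: (@bounded_intble _ _ _ mu _ 1).
  by apply: measurable_funM; [exact: measurable_presentR|exact: measurable_goodR].
by move=> z; rewrite -natrM normr_nat lern1; case: (present _ _); case: (good z).
Qed.

(** [good] depends on the prior coordinates only, hence is independent of the indicator of [e]. *)
Lemma good_present e : \int[mu]_z ((present (d := d) e z)%:R * (good z)%:R) = p * good_mass.
Proof.
pose f (s : R) : \bar R := ((s == 1)%:R)%:E.
have mf : measurable_fun setT f.
  apply/measurable_EFinP; apply: measurable_natr_bool.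
  exact: measurable_fun_eqr.
rewrite /Rintegral; under eq_integral do rewrite EFinM.
rewrite (integral_coordM imu (x := edge_ix d e) (f := f))//.
- rewrite -(Rintegral_ge0E measurable_goodR)//; last exact: intble_good.
  have -> : (\int[mu]_z f (z (edge_ix d e)) = p%:E)%E.
    rewrite -(present_prob e); have mset : measurable [set z : coords R (model_index n d) | present e z].
      have := @measurable_present R n d e measurableT [set true].
      by rewrite setTI; apply.
    transitivity (\int[mu]_z (\1_[set z | present (d := d) e z] z)%:E)%E; last first.
      by rewrite integral_indic// setIT.
    apply: eq_integral => z _.
    rewrite indicE; congr (_%:R%:E); congr nat_of_bool.
    by apply/idP/idP => [h|/set_mem//]; exact/mem_set.
  by [].
- by move=> s; rewrite lee_fin.
- by apply/measurable_EFinP; exact: measurable_goodR.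
Qed.

Section one_rotation.
Variables (u : R) (i : 'I_n) (k l : 'I_d).
Hypothesis kl : k != l.

Let rotated z := rotate_at (givens u k l) i (prior z).
Let x : R := 4 * (1 - rcos u) / sigma ^+ 2.
Let shiftee : seq (model_index n d) := [seq j <- enum (model_index n d) | is_noise j].
Let shift z := shift_coords shiftee (noise_shift sigma u i k l) z.

Let x0 : 0 <= x.
Proof.
rewrite divr_ge0 ?sqr_ge0// mulr_ge0// subr_ge0.
by have := rcos2Drsin2 u; nra.
Qed.

Definition skew_at (Z : coords R (model_index n d) -> 'I_n -> 'M[R]_d) z : R :=
  skew_entry (aligned_product (estimate z) (Z z) i) k l.

Lemma measurable_skew_at Z : (forall j, mx_measurable (fun z => Z z j)) ->
  measurable_fun setT (skew_at Z).
Proof.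
by move=> mZ; apply: measurable_funB; apply: measurable_aligned_product => //;
  exact: measurable_estimate.
Qed.

Lemma skew_at_le Z z : SOn (Z z) -> `|skew_at Z z| <= 2 * d%:R.
Proof.
move=> hZ; have hE := SOn_estimate z.
have := aligned_product_le n0 i k l hE hZ; have := aligned_product_le n0 i l k hE hZ.
by rewrite /skew_at /skew_entry => a b; apply: (le_trans (ler_normB _ _)); lra.
Qed.

Let F := on_good (skew_at rotated).
Let F0 := on_good (skew_at (@prior R n d)).

Let mF : measurable_fun setT F.
Proof.
by apply: measurable_on_good; apply: measurable_skew_at => j; exact: measurable_rotated.
Qed.

Let mF0 : measurable_fun setT F0.
Proof.
by apply: measurable_on_good; apply: measurable_skew_at => j; exact: measurable_prior.
Qed.

Let F_le z : `|F z| <= 2 * d%:R.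
Proof.
apply: on_good_le; rewrite ?mulr_ge0// => {}z /good_SOn gz.
by apply: skew_at_le; apply: SOn_rotate_at => //; exact: SO_givens.
Qed.

Let F0_le z : `|F0 z| <= 2 * d%:R.
Proof.
by apply: on_good_le; rewrite ?mulr_ge0// => {}z /good_SOn gz; exact: skew_at_le.
Qed.

Lemma Rintegral_rotate (f : coords R (model_index n d) -> R) (K : R) :
  measurable_fun setT f -> (forall z, `|f z| <= K) ->
  \int[mu]_z f (rotate_prior u i k l z) = \int[mu]_z f z.
Proof.
move=> mf fK.
have mfr : measurable_fun setT (fun z => f (rotate_prior u i k l z)).
  exact: (measurableT_comp mf (measurable_plane_rotations u _)).
have i_f : intble mu f by exact: (@bounded_intble _ _ _ mu _ K).
have i_fr : intble mu (fun z => f (rotate_prior u i k l z)).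
  exact: (@bounded_intble _ _ _ mu _ K mfr (fun z => fK _)).
have i_K : intble mu (fun=> K).
  by apply: (@bounded_intble _ _ _ mu _ `|K|).
(* Adding [K] makes the integrand nonnegative, as the invariance lemma requires. *)
apply: (@addIr _ (\int[mu]_z K)); rewrite -!RintegralD//.
congr fine; apply: (@integral_plane_rotations R (model_index n d) mu imu u _ (fun z => (f z + K)%:E)).
- by move=> e /mapP[m _ ->] /=; split=> //; rewrite prior_ix_eq eqxx (negbTE kl).
- by apply/measurable_EFinP; exact: measurable_funD.
- by move=> z; rewrite lee_fin; have := fK z; rewrite ler_norml => /andP[]; lra.
Qed.

(** Shifting the noise in [F] and rotating the prior coordinates in [F0] give pointwise the same
    parameter and the same estimate; invariance of the Gaussian law then removes the rotation. Hence
    the prior contributes no information term. *)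
Lemma on_good_shift : \int[mu]_z F (shift z) = \int[mu]_z F0 z.
Proof.
rewrite -(Rintegral_rotate mF0 F0_le); apply: eq_Rintegral => z _.
have off := shift_noise_off sigma u i k l z.
rewrite /F /F0 /on_good good_rotate// (good_off off); case: ifP => // _.
rewrite /skew_at /rotated /estimate (prior_off off) sample_rotate// prior_rotate//.
by rewrite sample_shift.
Qed.

Let N z : R := \sum_(e : edge n | incident i e) (present e z)%:R.

Let N0 z : 0 <= N z. Proof. exact: sumr_ge0. Qed.

Let N_le z : N z <= n%:R.
Proof.
apply: (@le_trans _ _ (\sum_(e : edge n | incident i e) 1)).
  by apply: ler_sum => e _; rewrite lern1 leq_b1.
by rewrite sumr_const ler_nat; exact: card_incident.
Qed.

Let sum_shiftE z : good z ->
  \sum_(j <- shiftee) noise_shift sigma u i k l j z ^+ 2 = x * N z.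
Proof.
move=> gz; rewrite sum_noise_shift /N mulr_sumr [RHS]big_mkcond; apply: eq_bigr => e _.
rewrite sqfrob_mean_shift// -/x; case: (incident i e); rewrite ?mul0r ?mulr0 ?mul1r//.
by rewrite mulrC.
Qed.

(** With [N] observed pairs at [i] the exponent is [x * N]. Its linear part is averaged, which
    produces the factor [p]; the quadratic part is bounded crudely through [N <= n], since it is of
    higher order in the angle. *)
Lemma chi_square_good : x * n%:R <= 2^-1 ->
  \int[mu]_z ((good z)%:R * expR (\sum_(j <- shiftee) noise_shift sigma u i k l j z ^+ 2))
    - \int[mu]_z (good z)%:R <=
  (x * n%:R * p + 2 * (x * n%:R) ^+ 2) * good_mass.
Proof.
move=> xn; have [p0 p1] := andP p01.
have [i_s E_s] := @Rintegral_sum _ _ _ mu _ (index_enum (edge n)) (incident i)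
  (fun e z => (present e z)%:R * (good z)%:R) intble_present_good.
have i_g := intble_good.
pose rhs z : R := (1 + 2 * (x * n%:R) ^+ 2) * (good z)%:R +
  x * \sum_(e : edge n | incident i e) (present e z)%:R * (good z)%:R.
have rhsE : \int[mu]_z rhs z <= good_mass + (x * n%:R * p + 2 * (x * n%:R) ^+ 2) * good_mass.
  rewrite /rhs RintegralD//; [|exact: intbleZ|exact: intbleZ].
  rewrite RintegralZl// RintegralZl// E_s.
  under eq_bigr do rewrite good_present.
  have gm0 : 0 <= good_mass by apply: Rintegral_ge0 => z _.
  rewrite sumr_const -/good_mass.
  apply: (@le_trans _ _ ((1 + 2 * (x * n%:R) ^+ 2) * good_mass + x * (n%:R * (p * good_mass)))).
    rewrite lerD2l ler_wpM2l// -[leLHS]mulr_natl ler_wpM2r ?mulr_ge0 ?(ltW p0)//.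
    by rewrite ler_nat; exact: card_incident.
  by rewrite le_eqVlt; apply/orP; left; apply/eqP; ring.
rewrite lerBlDl; apply: le_trans rhsE; apply: le_Rintegral => //.
- apply: (@bounded_intble _ _ _ mu _ (expR (x * n%:R))).
    apply: measurable_funM; first exact: measurable_goodR.
    apply: measurableT_comp => //; apply: measurable_sum => j; apply: measurable_funX.
    exact: measurable_noise_shift.
  move=> z; rewrite ger0_norm ?mulr_ge0 ?expR_ge0//.
  case: (boolP (good z)) => gz; last by rewrite mul0r expR_ge0.
  by rewrite mul1r ler_expR sum_shiftE// ler_wpM2l.
- by apply: intbleD; exact: intbleZ.
move=> z _; rewrite /rhs; case: (boolP (good z)) => gz; last first.
  by rewrite mul0r mulr0 big1 ?mulr0 ?addr0// => e _; rewrite mulr0.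
rewrite sum_shiftE// mul1r mulr1.
under eq_bigr do rewrite mulr1.
rewrite -/(N z); have xN : x * N z <= x * n%:R by exact: ler_wpM2l.
have xN0 : 0 <= x * N z by exact: mulr_ge0.
apply: le_trans (expR_le_quadratic _) _.
  by rewrite xN0 (le_trans xN).
have : (x * N z) ^+ 2 <= (x * n%:R) ^+ 2 by apply: lerXn2r; rewrite ?nnegrE// mulr_ge0.
by lra.
Qed.

Lemma information_step (theta : R) : 0 < theta -> x * n%:R <= 2^-1 ->
  2 * (\int[mu]_z F z - \int[mu]_z F0 z) <=
  theta * \int[mu]_z (F z ^+ 2) +
  theta^-1 * ((x * n%:R * p + 2 * (x * n%:R) ^+ 2) * good_mass).
Proof.
move=> th0 xn; rewrite -on_good_shift.
have shiftee_noise j : j \in shiftee -> is_noise j by rewrite mem_filter => /andP[].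
apply: (le_trans (@chi_square_shift R (model_index n d) mu imu (@is_noise n d) shiftee
  (noise_shift sigma u i k l) _ shiftee_noise _ _ _ (@good R n d) _ _ (x * n%:R)
  _ F (2 * d%:R) theta th0 mF F_le _)).
- by rewrite filter_uniq// enum_uniq.
- by move=> j /shiftee_noise; case: j => [//|[//|[e [a b]]]] _; exact: gaussian_noise.
- by move=> j; exact: measurable_noise_shift.
- by move=> j z z'; exact: noise_shift_off.
- exact: measurable_good.
- by move=> z z'; exact: good_off.
- by move=> z gz; rewrite sum_shiftE// ler_wpM2l.
- by move=> z /negbTE gz; rewrite /F /on_good gz.
- rewrite lerD2l; apply: ler_wpM2l; first by rewrite invr_ge0 ltW.
  exact: chi_square_good.
Qed.

End one_rotation.
End information.

(** Stands in for a limit: an error linear in [u] disappears because [u] is arbitrarily small. *)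
Lemma le_small_error (R : realType) (a b K u0 : R) : 0 < u0 ->
  (forall u, 0 < u <= u0 -> a <= b + u * K) -> a <= b.
Proof.
move=> u00 H; apply/ler_addgt0Pr => e e0.
have K0 : 0 < `|K| + 1 by rewrite ltr_wpDl.
pose u := Num.min u0 (e / (`|K| + 1)).
have up : 0 < u by rewrite lt_min u00 divr_gt0.
have ue : u <= e / (`|K| + 1) by rewrite ge_min lexx orbT.
have uu : u <= u0 by rewrite ge_min lexx.
apply: (le_trans (H u _)); first by rewrite up.
rewrite lerD2l; apply: (le_trans (ler_norm _)); rewrite normrM gtr0_norm//.
apply: (@le_trans _ _ (u * (`|K| + 1))); first by rewrite ler_pM2l// lerDl.
by rewrite -ler_pdivlMr.
Qed.

(** * The information inequality as the angle vanishes *)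

Section information_bound.
Context (R : realType) (n d : nat) (p sigma : R).
Variable mu : probability (coords R (model_index n d)) R.
Hypothesis imu : independent_coords mu.
Hypothesis gaussian_prior : forall i a b, gaussian_coord mu (prior_ix i a b).
Hypothesis gaussian_noise : forall e a b, gaussian_coord mu (noise_ix e a b).
Hypothesis present_prob : forall e : edge n, mu [set z | present (d := d) e z] = p%:E.
Hypotheses (p01 : 0 < p <= 1) (sigma0 : 0 < sigma) (n0 : (0 < n)%N).
Variable (Zh : data R n d -> 'I_n -> 'M[R]_d).
Hypothesis hZh : estimator Zh.
Implicit Types z : coords R (model_index n d).

Let eta : R := n%:R * p / sigma ^+ 2.
Let nR : 0 < n%:R :> R. Proof. by rewrite ltr0n. Qed.
Let p0 : 0 < p. Proof. by case/andP: p01. Qed.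
Let eta0 : 0 < eta. Proof. by rewrite divr_gt0 ?mulr_gt0 ?exprn_gt0. Qed.

Definition aligned_est i z : 'M[R]_d := aligned_product (estimate sigma Zh z) (prior z) i.

Definition diag_pair i (k l : 'I_d) z : R :=
  aligned_est i z k k + aligned_est i z l l - 2 / n%:R.

Lemma measurable_aligned_est i : mx_measurable (aligned_est i).
Proof.
by apply: measurable_aligned_product => //; [move=> j; exact: measurable_estimate|
  move=> j; exact: measurable_prior].
Qed.

Lemma aligned_est_le i z a b : good z -> `|aligned_est i z a b| <= d%:R.
Proof.
by move=> /good_SOn gz; apply: aligned_product_le => //; exact: SOn_estimate.
Qed.

Section one_pair.
Variables (i : 'I_n) (k l : 'I_d).
Hypothesis kl : k != l.

Let skew z : R := skew_entry (aligned_est i z) k l.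
Let F0 := on_good skew.
Let D := on_good (diag_pair i k l).
Let K0 : R := 2 * d%:R.
Let K1 : R := 2 * d%:R + 2.

Let mF0 : measurable_fun setT F0.
Proof.
by apply: measurable_on_good; apply: measurable_funB; exact: measurable_aligned_est.
Qed.

Let mD : measurable_fun setT D.
Proof.
apply: measurable_on_good; apply: measurable_funB => //.
by apply: measurable_funD; exact: measurable_aligned_est.
Qed.

Let K00 : 0 <= K0. Proof. by rewrite mulr_ge0. Qed.
Let K10 : 0 <= K1. Proof. by rewrite addr_ge0// mulr_ge0. Qed.

Let F0_le z : `|F0 z| <= K0.
Proof.
apply: on_good_le => // {}z gz; apply: (le_trans (ler_normB _ _)).
have := aligned_est_le i k l gz; have := aligned_est_le i l k gz.
by rewrite /K0; lra.
Qed.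

Let D_le z : `|D z| <= K1.
Proof.
apply: on_good_le => // {}z gz; apply: (le_trans (ler_normB _ _)).
have n2 : `|2 / n%:R| <= 2 :> R.
  by rewrite ger0_norm ?divr_ge0// ler_pdivrMr// ler_peMr// ler1n.
have := ler_normD (aligned_est i z k k) (aligned_est i z l l).
have := aligned_est_le i k k gz; have := aligned_est_le i l l gz.
by rewrite /K1; lra.
Qed.

Let i_F0 : intble mu F0. Proof. exact: (@bounded_intble _ _ _ mu _ K0). Qed.
Let i_D : intble mu D. Proof. exact: (@bounded_intble _ _ _ mu _ K1). Qed.
Let i_F02 : intble mu (fun z => F0 z ^+ 2).
Proof.
apply: (@bounded_intble _ _ _ mu _ (K0 ^+ 2)); first exact: measurable_funX.
by move=> z; rewrite normrX; apply: lerXn2r; rewrite ?nnegrE.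
Qed.
Let i_cst (c : R) : intble mu (fun=> c).
Proof. exact: (@bounded_intble _ _ _ mu _ `|c|). Qed.

Let rotated_skew u z : good z ->
  skew_at sigma Zh i k l (fun z => rotate_at (givens u k l) i (prior z)) z =
  rcos u * F0 z + rsin u * D z.
Proof.
move=> gz; rewrite /skew_at aligned_product_rotate//.
- by rewrite skew_entry_givens// /F0 /D /on_good gz.
- exact: SO_givens.
- exact: SOn_estimate.
- exact: good_SOn.
Qed.

(** [information_step] at a finite angle has a factor [s = rsin u] in every term. Dividing by it
    leaves the limiting inequality and a remainder bounded linearly in [u]. The bound
    [sigma ^+ 2 / (16 * n%:R)] on [u] guarantees [x * n%:R <= 2^-1]. *)
Let small_rotation u : 0 < u <= Num.min 1 (sigma ^+ 2 / (16 * n%:R)) ->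
  2 * \int[mu]_z D z <=
  eta * \int[mu]_z (F0 z ^+ 2) + 2 * good_mass mu + u *
    (2 * `|\int[mu]_z F0 z| + eta * (4 * K0 * K1 + 4 * K1 ^+ 2)
     + (2 + 32 * n%:R / (p * sigma ^+ 2)) * good_mass mu).
Proof.
rewrite le_min => /andP[u0 /andP[u1 us]].
set s := rsin u; set c := rcos u; set E0 := \int[mu]_z F0 z; set ED := \int[mu]_z D z.
set E2 := \int[mu]_z (F0 z ^+ 2); set gm := good_mass mu.
have u21 : 0 < 1 + u ^+ 2 by rewrite ltr_wpDr ?sqr_ge0.
have s0 : 0 < s by rewrite divr_gt0 ?mulr_gt0.
have s2u : s <= 2 * u by rewrite /s /rsin ler_pdivrMr//; nra.
(* The half-angle identity shows that [1 - c] is of second order, and supplies the factor [s] to be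
   divided out. *)
have usE : 1 - c = u * s by rewrite /c /s /rcos /rsin; field; rewrite gt_eqF.
have us2 : 4 * u = 2 * (1 + u ^+ 2) * s by rewrite /s /rsin; field; rewrite gt_eqF.
have c1 : `|c| <= 1.
  by rewrite ler_norml; have := rcos2Drsin2 u; rewrite -/c -/s => ?; apply/andP; split; nra.
pose x := 4 * (1 - c) / sigma ^+ 2.
have xE : x = 4 * u * s / sigma ^+ 2 by rewrite /x usE mulrA.
have sg0 : 0 < sigma ^+ 2 by rewrite exprn_gt0.
have xn : x * n%:R <= 2^-1.
  rewrite xE mulrAC ler_pdivrMr//.
  have h : u * (16 * n%:R) <= sigma ^+ 2 by rewrite -ler_pdivlMr ?mulr_gt0.
  have h2 : u * s * n%:R <= 2 * u * n%:R.
    by rewrite ler_pM2r//; apply: (le_trans _ s2u); rewrite -[leRHS]mul1r ler_pM2r.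
  by nra.
(* The weight [theta = s * eta] balances the two terms of Young's inequality to first order when
   [E2 = 2 * gm / eta], the value attained at the target risk. *)
have th0 : 0 < s * eta by rewrite mulr_gt0.
have := @information_step R n d p sigma mu imu gaussian_prior gaussian_noise
  present_prob p01 sigma0 n0 Zh hZh u i k l kl (s * eta) th0 xn.
rewrite -/c -/x -/gm; set F := on_good (skew_at _ _ _ _ _ _).
have FE z : F z = c * F0 z + s * D z.
  rewrite /F /on_good; case: ifPn => [gz|gz]; first by rewrite rotated_skew.
  by rewrite /F0 /D /on_good (negbTE gz) !mulr0 addr0.
have -> : on_good (skew_at sigma Zh i k l (@prior R n d)) = F0 by [].
have -> : \int[mu]_z F z = c * E0 + s * ED.
  under eq_Rintegral do rewrite FE.
  by rewrite RintegralD//; [rewrite !RintegralZl|exact: intbleZ|exact: intbleZ].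
have F2 : \int[mu]_z (F z ^+ 2) <= E2 + (2 * s * K0 * K1 + s ^+ 2 * K1 ^+ 2).
  have -> : E2 + (2 * s * K0 * K1 + s ^+ 2 * K1 ^+ 2) =
      \int[mu]_z (F0 z ^+ 2 + (2 * s * K0 * K1 + s ^+ 2 * K1 ^+ 2)).
    rewrite RintegralD//; last exact: i_cst.
    rewrite [X in _ = _ + X]Rintegral_cst// (_ : fine (mu setT) = 1) ?mulr1//.
    by rewrite (probability_setT mu).
  have F2_le z : F z ^+ 2 <= F0 z ^+ 2 + (2 * s * K0 * K1 + s ^+ 2 * K1 ^+ 2).
    have h0 := F0_le z; have h1 := D_le z.
    have hc : c ^+ 2 * F0 z ^+ 2 <= F0 z ^+ 2.
      rewrite ler_piMl ?sqr_ge0// -[c ^+ 2]real_normK ?num_real//.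
      by rewrite exprn_ile1.
    have hm : c * (F0 z * D z) <= K0 * K1.
      apply: (le_trans (ler_norm _)); rewrite normrM [`|F0 z * D z|]normrM.
      apply: (@le_trans _ _ (1 * (`|F0 z| * `|D z|))).
        by apply: ler_wpM2r; [exact: mulr_ge0|exact: c1].
      by rewrite mul1r ler_pM.
    have hd : D z ^+ 2 <= K1 ^+ 2.
      by rewrite -[D z ^+ 2]real_normK ?num_real// lerXn2r ?nnegrE.
    have hms : s * (c * (F0 z * D z)) <= s * (K0 * K1) by rewrite ler_pM2l.
    have hds : s ^+ 2 * D z ^+ 2 <= s ^+ 2 * K1 ^+ 2 by rewrite ler_pM2l ?exprn_gt0.
    by rewrite FE; lra.
  have mF2 : measurable_fun setT (fun z => F z ^+ 2).
    apply: measurable_funX; rewrite (_ : F = fun z => c * F0 z + s * D z).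
      by apply: measurable_funD; apply: measurable_funM.
    by apply: funext => z; exact: FE.
  apply: le_Rintegral => //.
  - apply: (@bounded_intble _ _ _ mu _ (K0 ^+ 2 + (2 * s * K0 * K1 + s ^+ 2 * K1 ^+ 2))) => // z.
    rewrite ger0_norm ?sqr_ge0//; apply: (le_trans (F2_le z)); rewrite lerD2r.
    by rewrite -[F0 z ^+ 2]real_normK ?num_real// lerXn2r ?nnegrE.
  - by apply: intbleD.
move=> step.
have gm0 : 0 <= gm by apply: Rintegral_ge0.
have step2 : s * (2 * ED) <= s * (2 * (u * E0) + eta * (E2 + (2 * s * K0 * K1 + s ^+ 2 * K1 ^+ 2))
    + (2 * (1 + u ^+ 2) + 32 * u ^+ 2 * n%:R / (p * sigma ^+ 2)) * gm).
  have e1 : (s * eta)^-1 * ((x * n%:R * p + 2 * (x * n%:R) ^+ 2) * gm) =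
      s * ((2 * (1 + u ^+ 2) + 32 * u ^+ 2 * n%:R / (p * sigma ^+ 2)) * gm).
    have -> : s * ((2 * (1 + u ^+ 2) + 32 * u ^+ 2 * n%:R / (p * sigma ^+ 2)) * gm) =
        (2 * (1 + u ^+ 2) * s + s * (32 * u ^+ 2 * n%:R / (p * sigma ^+ 2))) * gm by ring.
    rewrite -us2 xE /eta; field.
    by rewrite !gt_eqF.
  rewrite e1 in step.
  have e2 : s * eta * \int[mu]_z (F z ^+ 2) <=
      s * eta * (E2 + (2 * s * K0 * K1 + s ^+ 2 * K1 ^+ 2)) by rewrite ler_pM2l.
  have e3 : 2 * (c * E0 + s * ED - E0) = s * (2 * ED) - s * (2 * (u * E0)).
    by rewrite -[c]opprK -[- c](addKr 1) usE; ring.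
  by move: step; rewrite e3 => step; lra.
rewrite ler_pM2l// in step2; apply: (le_trans step2).
have a1 : u * E0 <= u * `|E0| by rewrite ler_pM2l// ler_norm.
have uu : u ^+ 2 <= u by rewrite expr2 ler_piMr// ltW.
have a2 : 2 * s * K0 * K1 <= u * (4 * K0 * K1).
  have : s * (K0 * K1) <= 2 * u * (K0 * K1) by apply: ler_wpM2r => //; exact: mulr_ge0.
  by lra.
have a3 : s ^+ 2 * K1 ^+ 2 <= u * (4 * K1 ^+ 2).
  have : s ^+ 2 <= 4 * u by nra.
  by move=> h; have := ler_wpM2r (sqr_ge0 K1) h; lra.
have a4 : eta * (2 * s * K0 * K1 + s ^+ 2 * K1 ^+ 2) <= eta * (u * (4 * K0 * K1 + 4 * K1 ^+ 2)).
  by rewrite ler_pM2l//; lra.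
have a5 : u ^+ 2 * gm <= u * gm by exact: ler_wpM2r.
have a6 : u ^+ 2 * (32 * n%:R / (p * sigma ^+ 2) * gm) <= u * (32 * n%:R / (p * sigma ^+ 2) * gm).
  by apply: ler_wpM2r => //; rewrite mulr_ge0// divr_ge0 ?mulr_ge0// ltW.
set q := 32 * n%:R / (p * sigma ^+ 2) in a6 *.
have -> : 32 * u ^+ 2 * n%:R / (p * sigma ^+ 2) = u ^+ 2 * q by rewrite /q; ring.
by lra.
Qed.

Lemma information_bound :
  2 * \int[mu]_z D z <= eta * \int[mu]_z (F0 z ^+ 2) + 2 * good_mass mu.
Proof.
apply: (@le_small_error _ _ _ _ (Num.min 1 (sigma ^+ 2 / (16 * n%:R)))) => [|u]; last first.
  exact: small_rotation.
by rewrite lt_min ltr01 divr_gt0 ?exprn_gt0// mulr_gt0.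
Qed.

End one_pair.
End information_bound.

(** * Summation over matrices and coordinate planes *)

Section prior_risk.
Context (R : realType) (n d : nat) (p sigma : R).
Variable mu : probability (coords R (model_index n d)) R.
Hypothesis imu : independent_coords mu.
Hypothesis gaussian_prior : forall i a b, gaussian_coord mu (prior_ix i a b).
Hypothesis gaussian_noise : forall e a b, gaussian_coord mu (noise_ix e a b).
Hypothesis present_prob : forall e : edge n, mu [set z | present (d := d) e z] = p%:E.
Hypotheses (p01 : 0 < p <= 1) (sigma0 : 0 < sigma) (n0 : (0 < n)%N).
Variable (Zh : data R n d -> 'I_n -> 'M[R]_d).
Hypothesis hZh : estimator Zh.
Implicit Types z : coords R (model_index n d).

Let eta : R := n%:R * p / sigma ^+ 2.
Let pairs : R := d%:R * (d%:R - 1) / 2.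
Let r z : R := misalignment (estimate sigma Zh z) (prior z).
Let N i z := aligned_est sigma Zh i z.
Let skew2 i k l z : R := on_good (fun z => skew_entry (N i z) k l) z ^+ 2.
Let D i k l := on_good (diag_pair sigma Zh i k l).

Definition sum_pairs (f : 'I_n -> 'I_d -> 'I_d -> R) : R :=
  \sum_(i < n) \sum_(k < d) \sum_(l < d | (k < l)%N) f i k l.

Lemma measurable_risk_integrand : measurable_fun setT (on_good r).
Proof.
apply: measurable_on_good; apply: measurable_misalignment => j.
  exact: measurable_estimate.
exact: measurable_prior.
Qed.

Lemma risk_integrand_ge0 z : 0 <= on_good r z.
Proof.
rewrite /on_good; case: ifP => // /good_SOn gz.
by apply: misalignment_ge0 => //; exact: SOn_estimate.
Qed.

Lemma risk_integrand_le z : on_good r z <= d%:R.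
Proof.
rewrite /on_good; case: ifP => // _.
by rewrite /r /misalignment lerBlDr lerDl sqfrob_ge0.
Qed.

Lemma intble_risk : intble mu (on_good r).
Proof.
apply: (@bounded_intble _ _ _ mu _ d%:R); first exact: measurable_risk_integrand.
by move=> z; rewrite ger0_norm ?risk_integrand_ge0 ?risk_integrand_le.
Qed.

Let sum_pairs_cst (c : R) : sum_pairs (fun _ _ _ => c) = n%:R * (pairs * c).
Proof.
rewrite /sum_pairs sumr_const card_ord -[LHS]mulr_natl; congr (_ * _).
(* At the identity each pair contributes 2, so this counts the pairs. *)
have := sum_diag_pairs (1%:M : 'M[R]_d); rewrite mxtrace1.
under eq_bigr do under eq_bigr do rewrite !mxE !eqxx -mulr2n.
have -> : \sum_(k < d) \sum_(l < d | (k < l)%N) c =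
    c * \sum_(k < d) \sum_(l < d | (k < l)%N) 1.
  by rewrite mulr_sumr; apply: eq_bigr => k _; rewrite mulr_sumr;
    apply: eq_bigr => l _; rewrite mulr1.
have -> : \sum_(k < d) \sum_(l < d | (k < l)%N) 1 *+ 2 =
    2 * \sum_(k < d) \sum_(l < d | (k < l)%N) 1 :> R.
  by rewrite mulr_sumr; apply: eq_bigr => k _; rewrite mulr_sumr;
    apply: eq_bigr => l _; rewrite mulr1.
set S := \sum_(k < d) _ => h.
have -> : S = pairs by rewrite /pairs; lra.
by rewrite mulrC.
Qed.

Let Rintegral_sum_pairs (f : 'I_n -> 'I_d -> 'I_d -> coords R (model_index n d) -> R) :
  (forall i k l, intble mu (f i k l)) ->
  intble mu (fun z => sum_pairs (fun i k l => f i k l z)) /\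
  \int[mu]_z sum_pairs (fun i k l => f i k l z) =
  sum_pairs (fun i k l => \int[mu]_z f i k l z).
Proof.
move=> fi.
have S1 i (k : 'I_d) := @Rintegral_sum _ _ _ mu _ (index_enum 'I_d) (fun l => (k < l)%N) (f i k) (fi i k).
have S2 i := @Rintegral_sum _ _ _ mu _ (index_enum 'I_d) xpredT _ (fun k => (S1 i k).1).
have S3 := @Rintegral_sum _ _ _ mu _ (index_enum 'I_n) xpredT _ (fun i => (S2 i).1).
split; first exact: S3.1.
rewrite S3.2; apply: eq_bigr => i _; rewrite (S2 i).2; apply: eq_bigr => k _.
exact: (S1 i k).2.
Qed.

Let nR : 0 < n%:R :> R. Proof. by rewrite ltr0n. Qed.

Let sum_D z : good z ->
  sum_pairs (fun i k l => D i k l z) = n%:R * (d%:R - 1) * (d%:R - r z) - 2 * pairs.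
Proof.
move=> gz; transitivity (sum_pairs (fun i k l => N i z k k + N i z l l)
    - sum_pairs (fun _ _ _ => 2 / n%:R)).
  rewrite /sum_pairs -sumrB; apply: eq_bigr => i _; rewrite -sumrB; apply: eq_bigr => k _.
  by rewrite -sumrB; apply: eq_bigr => l _; rewrite /D /on_good gz.
rewrite sum_pairs_cst /sum_pairs.
under eq_bigr do rewrite sum_diag_pairs.
rewrite -mulr_sumr sum_mxtrace_aligned// /r /misalignment.
by field; rewrite gt_eqF.
Qed.

Let sum_skew2 z : sum_pairs (fun i k l => skew2 i k l z) <= 2 * n%:R * on_good r z.
Proof.
rewrite /skew2 /on_good; case: ifP => [/good_SOn gz|_]; last first.
  by rewrite expr0n/= sum_pairs_cst !mulr0.
rewrite -mulrA -sum_sqfrob_aligned//; last exact: SOn_estimate.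
by rewrite mulr_sumr; apply: ler_sum => i _; exact: sum_skew_entry.
Qed.

(** Each diagonal entry lies in [d - 1] planes, so the summed traces lose [n * (d - 1)] times the
    risk; moved to the right, this loss is the [d%:R - 1] beside [eta]. *)
Lemma prior_risk_bound :
  pairs * (1 - 2 / n%:R) * good_mass mu <= (eta + (d%:R - 1)) * \int[mu]_z on_good r z.
Proof.
set gm := good_mass mu; set Er := \int[mu]_z on_good r z.
have NK i k l z : good z -> `|N i z k l| <= d%:R by exact: aligned_est_le.
have mN i : mx_measurable (N i) by exact: measurable_aligned_est.
have i_D i k l : intble mu (D i k l).
  apply: (@bounded_intble _ _ _ mu _ (2 * d%:R + `|2 / n%:R|)).
    by apply: measurable_on_good; apply: measurable_funB => //; apply: measurable_funD; exact: mN.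
  apply: on_good_le => [|z gz]; first by rewrite addr_ge0// mulr_ge0.
  apply: (le_trans (ler_normB _ _)); rewrite lerD2r; apply: (le_trans (ler_normD _ _)).
  by have := NK i k k z gz; have := NK i l l z gz; rewrite /N; lra.
have i_skew i k l : intble mu (skew2 i k l).
  apply: (@bounded_intble _ _ _ mu _ ((2 * d%:R) ^+ 2)).
    apply: measurable_funX; apply: measurable_on_good; apply: measurable_funB; exact: mN.
  move=> z; rewrite normrX; apply: lerXn2r; rewrite ?nnegrE ?mulr_ge0//.
  apply: on_good_le => [|{}z gz]; first by rewrite mulr_ge0.
  apply: (le_trans (ler_normB _ _)).
  by have := NK i k l z gz; have := NK i l k z gz; lra.
have [i_sD sD] := Rintegral_sum_pairs i_D.
have [i_sS sS] := Rintegral_sum_pairs i_skew.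
have ineq : 2 * sum_pairs (fun i k l => \int[mu]_z D i k l z) <=
    eta * sum_pairs (fun i k l => \int[mu]_z skew2 i k l z)
    + sum_pairs (fun _ _ _ => 2 * gm).
  rewrite /sum_pairs !mulr_sumr -big_split/=; apply: ler_sum => i _.
  rewrite !mulr_sumr -big_split/=; apply: ler_sum => k _.
  rewrite !mulr_sumr -big_split/=; apply: ler_sum => l kl.
  by apply: information_bound => //; rewrite neq_ltn kl.
have i_g := intble_good mu; have i_r := intble_risk.
have lhs : sum_pairs (fun i k l => \int[mu]_z D i k l z) =
    n%:R * (d%:R - 1) * (d%:R * gm - Er) - 2 * pairs * gm.
  rewrite -sD; transitivity (\int[mu]_z ((n%:R * (d%:R - 1) * d%:R - 2 * pairs) * (good z)%:R
      - n%:R * (d%:R - 1) * on_good r z)).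
    apply: eq_Rintegral => z _; case: (boolP (good z)) => gz.
      by rewrite sum_D// /on_good gz (_ : true%:R = 1 :> R)//; ring.
    rewrite /D /on_good (negbTE gz) (_ : sum_pairs _ = n%:R * (pairs * 0)) ?sum_pairs_cst//.
    by rewrite !mulr0 subr0.
  rewrite RintegralB//; [|exact: intbleZ|exact: intbleZ].
  by rewrite !RintegralZl// -/(good_mass mu) -/gm -/Er; ring.
have rhs : sum_pairs (fun i k l => \int[mu]_z skew2 i k l z) <= 2 * n%:R * Er.
  rewrite -sS -RintegralZl//; apply: le_Rintegral => //; first exact: intbleZ.
have eta0 : 0 <= eta.
  by case/andP: p01 => p0 _; rewrite divr_ge0 ?sqr_ge0// mulr_ge0// ltW.
have rhs2 := ler_wpM2l eta0 rhs.
rewrite lhs sum_pairs_cst in ineq.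
rewrite -(ler_pM2l nR) -(ler_pM2l (ltr0n R 2)).
have -> : 2 * (n%:R * (pairs * (1 - 2 / n%:R) * gm)) = 2 * pairs * gm * n%:R - 4 * pairs * gm.
  by field; rewrite gt_eqF.
have E : 2 * pairs = d%:R * (d%:R - 1) by rewrite /pairs; field.
have E2 : n%:R * (d%:R - 1) * (d%:R * gm - Er) = n%:R * gm * (2 * pairs) - n%:R * (d%:R - 1) * Er.
  by rewrite E; ring.
by rewrite E2 in ineq; lra.
Qed.

End prior_risk.

(** * Independence on the doubled probability space *)

(** The edges of the cycle through all vertices: [i] goes to the edge from [i] to [i + 1], and the
    last vertex to the closing edge. With only two vertices these two edges would coincide. *)
Lemma edges_injection (n : nat) : (2 < n)%N -> exists f : 'I_n -> edge n, injective f.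
Proof.
case: n => [//|n] n2.
pose pr (i : 'I_n.+1) : 'I_n.+1 * 'I_n.+1 :=
  if (i < n)%N then (i, inord i.+1) else (ord0, i).
have lt i : ((pr i).1 < (pr i).2)%N.
  rewrite /pr; case: (ltnP i n) => [h /=|h /=]; first by rewrite inordK// ltnS.
  by apply: leq_trans h; exact: (ltnW (n2 : (1 < n)%N)).
exists (fun i => exist _ (pr i) (lt i)) => i j [] /=; rewrite /pr.
case: (ltnP i n) => hi; case: (ltnP j n) => hj; case => //.
- move=> i0 j1; exfalso; move: hj; rewrite -j1 inordK ?ltnS// i0 /=.
  by move=> h; have := leq_trans (n2 : (1 < n)%N) h.
- move=> i0 j1; exfalso; move: hi; rewrite j1 inordK ?ltnS// -i0 /=.
  by move=> h; have := leq_trans (n2 : (1 < n)%N) h.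
Qed.

Section independent_families.
Context disp (Omega : measurableType disp) (R : realType) (P : probability Omega R).

(** Independence is applied to the image of [h]; injectivity turns the product over the image into a
    product over [K]. *)
Lemma mutually_independent_inj (I K : finType) (F : I -> set (set Omega))
    (h : K -> I) (E : K -> set Omega) :
  mutually_independent P F -> injective h -> (forall k, F (h k) (E k)) ->
  P [set w | forall k, E k w] = (\prod_(k : K) P (E k))%E.
Proof.
move=> ind hinj FE.
pose E' x := if [pick k | h k == x] is Some k then E k else setT.
have E'h k : E' (h k) = E k.
  rewrite /E'; case: pickP => [k' /eqP /hinj -> //|/(_ k)].
  by rewrite eqxx.
have := ind (h @: [set: K])%SET E'.
have -> : \bigcap_(i in [set` (h @: [set: K])%SET]) E' i = [set w | forall k, E k w].
  apply/seteqP; split => w /= H.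
    by move=> k; rewrite -E'h; apply: H => /=; exact: imset_f.
  by move=> _ /= /imsetP[k _ ->]; rewrite E'h.
move=> ->; last by move=> _ /imsetP[k _ ->]; rewrite E'h.
rewrite big_imset/=; last by move=> ? ? _ _; exact: hinj.
by apply: eq_big => [k|k _]; [rewrite inE|rewrite E'h].
Qed.

End independent_families.

Section doubled_space.
Context (R : realType) (n d : nat) (disp : measure_display)
  (Omega : measurableType disp) (P : probability Omega R).
Variables (A : edge n -> {RV P >-> bool})
  (W : edge n -> 'I_d -> 'I_d -> {RV P >-> R}) (p : R).
Hypothesis noise : sync_noise A W p.
Hypothesis p01 : 0 < p <= 1.
Variable (f : 'I_n -> edge n).
Hypothesis f_inj : injective f.

(* The noise of the first copy of [Omega] generates the prior. *)
Definition coordinates (w : Omega * Omega) : coords R (model_index n d) :=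
  fun j => match j with
  | inl (i, (a, b)) => W (f i) a b w.1
  | inr (inl e) => (A e w.2)%:R
  | inr (inr (e, (a, b))) => W e a b w.2
  end.

Lemma measurable_coordinates : measurable_fun setT coordinates.
Proof.
apply: measurable_coords => -[[i [a b]]|[e|[e [a b]]]] /=.
- by apply: measurableT_comp => //; exact: measurable_fst.
- apply: measurable_natr_bool; apply: measurableT_comp => //; exact: measurable_snd.
- by apply: measurableT_comp => //; exact: measurable_snd.
Qed.

Definition joint_law : probability (coords R (model_index n d)) R :=
  distribution (P \x P)%E (@mfun_Sub _ _ (Omega * Omega)%type (coords R (model_index n d))
    coordinates (mem_set measurable_coordinates)).

Lemma joint_lawE B : joint_law B = (P \x P)%E (coordinates @^-1` B).
Proof. by []. Qed.

Let prior_event (B : model_index n d -> set R) (x : 'I_n * ('I_d * 'I_d)) : set Omega :=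
  W (f x.1) x.2.1 x.2.2 @^-1` B (inl x).
Let data_event (B : model_index n d -> set R) (x : edge n + edge n * ('I_d * 'I_d)) : set Omega :=
  match x with
  | inl e => (fun w => (A e w)%:R : R) @^-1` B (inr x)
  | inr (e, (a, b)) => W e a b @^-1` B (inr x)
  end.

Let measurable_prior_event B x : (forall j, measurable (B j)) -> measurable (prior_event B x).
Proof. by move=> mB; rewrite -[X in measurable X]setTI; apply: measurable_funPT. Qed.

Let measurable_data_event B x : (forall j, measurable (B j)) -> measurable (data_event B x).
Proof.
move=> mB; case: x => [e|[e [a b]]] /=; rewrite -[X in measurable X]setTI.
  have mA : measurable_fun setT (fun w => (A e w)%:R : R) by exact: measurable_natr_bool.
  exact: mA.
exact: measurable_funPT.
Qed.

(** The prior coordinates read only the first copy of [Omega] and the data only the second, so a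
    rectangle pulls back to a product event; each side then factors by the independence of the
    noise. *)
Let joint_rectangle B : (forall j, measurable (B j)) ->
  joint_law (rectangle B) =
  ((\prod_x P (prior_event B x)) * (\prod_x P (data_event B x)))%E.
Proof.
move=> mB; have [_ _ ind] := noise; rewrite joint_lawE.
have -> : coordinates @^-1` rectangle B =
    [set w | forall x, prior_event B x w] `*` [set w | forall x, data_event B x w].
  apply/seteqP; split => -[w1 w2] /=.
    move=> H; split => [[i [a b]]|[e|[e [a b]]]]; first exact: (H (inl (i, (a, b)))).
      exact: (H (inr (inl e))).
    exact: (H (inr (inr (e, (a, b))))).
  move=> [H1 H2] [[i [a b]]|[e|[e [a b]]]]; first exact: (H1 (i, (a, b))).
    exact: (H2 (inl e)).
  exact: (H2 (inr (e, (a, b)))).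
have mE (K : finType) (E : K -> set Omega) : (forall k, measurable (E k)) ->
    measurable [set w | forall k, E k w].
  move=> mE; rewrite (_ : [set w | _] = \bigcap_(k in [set: K]) E k).
    by apply: fin_bigcap_measurable => //.
  by apply/seteqP; split => w H; [move=> k _; exact: H|move=> k; exact: H].
rewrite product_measure1E//; last 2 first.
- by apply: mE => x; exact: measurable_prior_event.
- by apply: mE => x; exact: measurable_data_event.
congr (_ * _)%E.
  apply: (mutually_independent_inj (h := fun x => inr (f x.1, x.2)) ind).
    (* Injectivity of [f] keeps the noise entries of different prior matrices distinct. *)
    by move=> [i x] [j y] [/f_inj -> ->].
  by move=> [i [a b]]; exists (B (inl (i, (a, b)))) => //; rewrite setTI.
apply: (mutually_independent_inj (h := id) ind) => //.
move=> [e|[e [a b]]] /=.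
  exists ((fun b : bool => b%:R : R) @^-1` B (inr (inl e))) => //; rewrite setTI//.
by exists (B (inr (inr (e, (a, b))))) => //; rewrite setTI.
Qed.

Let P_setT : P setT = 1%E. Proof. exact: probability_setT. Qed.

Lemma joint_coord (j : model_index n d) (B : set R) : measurable B ->
  joint_law (coord j @^-1` B) =
  match j with
  | inl (i, (a, b)) => P (W (f i) a b @^-1` B)
  | inr (inl e) => P ((fun w => (A e w)%:R : R) @^-1` B)
  | inr (inr (e, (a, b))) => P (W e a b @^-1` B)
  end.
Proof.
move=> mB; pose BB k := if k == j then B else setT.
have -> : coord j @^-1` B = rectangle BB.
  apply/seteqP; split => z /=; last by move=> /(_ j); rewrite /BB eqxx.
  by move=> zj k; rewrite /BB; case: eqP => [->|].
rewrite joint_rectangle; last by move=> k; rewrite /BB; case: ifP.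
have dT x : inr x != j -> P (data_event BB x) = 1%E.
  by case: x => [e|[e [a b]]] /negbTE xj /=; rewrite /BB xj preimage_setT.
have pT x : inl x != j -> P (prior_event BB x) = 1%E.
  by move=> /negbTE xj /=; rewrite /prior_event /BB xj preimage_setT.
case: j @BB dT pT => [x|x] BB dT pT.
  rewrite [X in (_ * X)%E]big1 => [|y _]; last exact: dT.
  rewrite mule1 (bigD1 x)//= big1 => [|y yx]; last exact: pT.
  by rewrite mule1 /prior_event /BB eqxx; case: x {BB dT pT} => i [a b].
rewrite [X in (X * _)%E]big1 => [|y _]; last exact: pT.
rewrite mul1e (bigD1 x)//= big1 => [|y yx]; last exact: dT.
by rewrite mule1; case: x @BB dT pT => [e|[e [a b]]] BB dT pT /=; rewrite /BB eqxx.
Qed.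

Lemma joint_independent : independent_coords joint_law.
Proof.
move=> B mB; rewrite joint_rectangle// [RHS]big_sumType/=; congr (_ * _)%E.
  by apply: eq_bigr => -[i [a b]] _; exact: (esym (joint_coord (inl (i, (a, b))) (mB _))).
by apply: eq_bigr => -[e|[e [a b]]] _;
  [exact: (esym (joint_coord (inr (inl e)) (mB _)))|
   exact: (esym (joint_coord (inr (inr (e, (a, b)))) (mB _)))].
Qed.

Lemma joint_gaussian_prior i a b : gaussian_coord joint_law (prior_ix i a b).
Proof. by have [_ gW _] := noise; move=> B mB; rewrite joint_coord//; exact: gW. Qed.

Lemma joint_gaussian_noise e a b : gaussian_coord joint_law (noise_ix e a b).
Proof. by have [_ gW _] := noise; move=> B mB; rewrite joint_coord//; exact: gW. Qed.

Lemma joint_present e : joint_law [set z | present e z] = p%:E.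
Proof.
have [gA _ _] := noise.
have -> : [set z : coords R (model_index n d) | present e z] = coord (edge_ix d e) @^-1` [set 1].
  by apply/seteqP; split => z /= /eqP.
rewrite (joint_coord (edge_ix d e) (@measurable_set1 R 1))/=.
have -> : (fun w => (A e w)%:R : R) @^-1` [set 1] = A e @^-1` [set true].
  apply/seteqP; split => w /=; last by move=> ->.
  by case: (A e w) => // /eqP; rewrite eq_sym oner_eq0.
have := gA e [set true]; rewrite /distribution /pushforward => -> //.
case/andP: p01 => p0 p1.
by rewrite bernoulli_probE ?(ltW p0) ?p1// !diracE mem_set// memNset// mule1 mule0 adde0.
Qed.

End doubled_space.

(** * Positive mass of the good event *)

Section positivity.
Context (R : realType).

(** On the ball the density is at least its value [c] at distance [|x| + e] from the origin, and the
    ball has positive length. *)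
Lemma normal_prob_ball_gt0 (x e : R) : 0 < e -> (0 < normal_prob 0 1 (ball x e))%E.
Proof.
move=> e0; pose c := normal_peak (1 : R) * expR (- (`|x| + e) ^+ 2 / 2).
have c0 : 0 < c by rewrite mulr_gt0 ?expR_gt0// normal_peak_gt0// oner_neq0.
apply: (@lt_le_trans _ _ (\int[lebesgue_measure]_(y in ball x e) c%:E)%E).
  rewrite integral_cst; last exact: measurable_ball.
  by rewrite mule_gt0//= lebesgue_measure_ball ?ltW// lte_fin mulrn_wgt0.
apply: ge0_le_integral => //.
- exact: measurable_ball.
- by move=> y _; rewrite lee_fin ltW.
- by apply/measurable_EFinP; apply: measurable_funTS; exact: measurable_normal_pdf.
move=> y xy; rewrite lee_fin normal_pdfE ?oner_neq0// ler_pM2l ?normal_peak_gt0 ?oner_neq0//.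
rewrite /normal_fun ler_expR subr0 expr1n mulr2n !mulNr lerN2.
have h : `|y| <= `|x| + e.
  have -> : y = x - (x - y) by rewrite opprB addrC subrK.
  apply: (le_trans (ler_normB _ _)); rewrite lerD2l ltW//.
have : y ^+ 2 <= (`|x| + e) ^+ 2.
  by rewrite -[y ^+ 2]real_normK ?num_real// lerXn2r ?nnegrE// addr_ge0// ltW.
by rewrite (_ : 1 + 1 = 2 :> R)//; lra.
Qed.

(** For nonnegative functions the integral is a supremum over simple functions below, so
    monotonicity holds without measurability. This allows comparison with [loss], an infimum whose
    measurability is never established. *)
Lemma ge0_le_integral_all disp (T : measurableType disp)
    (mu : {measure set T -> \bar R}) (f g : T -> \bar R) :
  (forall x, 0 <= f x)%E -> (forall x, f x <= g x)%E ->
  (\int[mu]_x f x <= \int[mu]_x g x)%E.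
Proof.
move=> f0 fg; have g0 x : (0 <= g x)%E by exact: le_trans (fg x).
rewrite !ge0_integralTE//; apply: ereal_sup_le => _ [h hf <-].
by exists h => // x; exact: le_trans (fg x).
Qed.

(** If all Gaussian entries are close to those of the identity, every orthonormalisation is a
    rotation. By independence the mass of that box is a product of positive factors. *)
Lemma good_mass_gt0 (n d : nat) (mu : probability (coords R (model_index n d)) R) :
  independent_coords mu -> (forall i a b, gaussian_coord mu (prior_ix i a b)) ->
  0 < good_mass mu.
Proof.
move=> imu gp; have [e e0 He] := gram_schmidt_near1 R d.
pose B (j : model_index n d) : set R :=
  if j is inl (i, (a, b)) then ball ((a == b)%:R : R) e else setT.
have mB j : measurable (B j).
  by case: j => [[i [a b]]|x] /=; [exact: measurable_ball|exact: measurableT].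
rewrite -lte_fin Rintegral_ge0E//; [|exact: measurable_goodR|exact: intble_good].
apply: (@lt_le_trans _ _ (mu (rectangle B))).
  rewrite imu//; apply: (big_ind (fun x => (0 < x)%E)) => //.
    by move=> x y x0 y0; exact: mule_gt0.
  move=> [[i [a b]]|x] _ /=; last by rewrite preimage_setT probability_setT.
  rewrite (gp i a b); last exact: measurable_ball.
  exact: normal_prob_ball_gt0.
have -> : mu (rectangle B) = (\int[mu]_z (\1_(rectangle B) z)%:E)%E.
  by rewrite integral_indic ?setIT//; exact: measurable_rectangle.
apply: ge0_le_integral_all => z; first by rewrite lee_fin.
rewrite lee_fin indicE; case: (boolP (z \in rectangle B)) => // /set_mem zB.
rewrite ler_nat lt0b; apply/forallP => i; apply: He => a b.
rewrite mxE distrC.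
have := zB (prior_ix i a b); rewrite /B /= /ball /=.
by [].
Qed.

End positivity.

(** * From the Bayes risk to the minimax risk *)

Section bayes.
Context (R : realType) (n d : nat) (disp : measure_display)
  (Omega : measurableType disp) (P : probability Omega R).
Variables (A : edge n -> {RV P >-> bool})
  (W : edge n -> 'I_d -> 'I_d -> {RV P >-> R}) (p sigma : R).
Hypotheses (noise : sync_noise A W p) (p01 : 0 < p <= 1) (sigma0 : 0 < sigma).
Hypothesis n0 : (0 < n)%N.
Variables (f : 'I_n -> edge n) (f_inj : injective f).
Variable Zh : data R n d -> 'I_n -> 'M[R]_d.
Hypothesis hZh : estimator Zh.

Let mu := joint_law A W f.
Let r z : R := misalignment (estimate sigma Zh z) (prior z).

(** The prior reads only the first copy; [point] is a dummy for the second. *)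
Let prior_coordinates w1 w2 : prior (coordinates A W f (w1, w2)) =
  prior (coordinates A W f (w1, point)).
Proof. by []. Qed.

Lemma sample_coordinates Z w1 w2 :
  sample sigma Z (coordinates A W f (w1, w2)) = observation A W sigma Z w2.
Proof.
apply/funext => e; rewrite /sample /observation /present /=.
rewrite (_ : ((A e w2)%:R == 1 :> R) = A e w2); last first.
  by case: (A e w2); rewrite ?eqxx// eq_sym oner_eq0.
by case: ifP => // _; congr (Some (_ + _ *: _)); apply/matrixP => a b; rewrite !mxE.
Qed.

Lemma risk_ge0 Z : SOn Z -> (0 <= risk A W sigma Zh Z)%E.
Proof.
move=> hZ; rewrite /risk unlock; apply: integral_ge0 => w _; rewrite lee_fin.
have h := hZh.1 (observation A W sigma Z w).
by apply: le_trans (misalignment_le_loss n0 h hZ); exact: misalignment_ge0.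
Qed.

(** By Tonelli, with the first copy frozen the parameter is a fixed [Z], and the inner integral is
    at most the risk at [Z] if [Z] is good and 0 otherwise. *)
Lemma bayes_risk_le (rho : R) : 0 <= rho ->
  (forall Z, SOn Z -> (risk A W sigma Zh Z <= rho%:E)%E) ->
  \int[mu]_z on_good r z <= rho * good_mass mu.
Proof.
move=> rho0 Hrho.
have mr : measurable_fun setT (on_good r) := measurable_risk_integrand sigma hZh.
have mc := measurable_coordinates A W f.
have r0 z : 0 <= on_good r z by exact: risk_integrand_ge0.
have i_good := intble_good mu.
rewrite -RintegralZl// -lee_fin.
have mg : measurable_fun setT (fun z : coords R (model_index n d) => rho * (good z)%:R).
  by apply: measurable_funM => //; exact: measurable_goodR.
rewrite !Rintegral_ge0E//; last 3 first.
- by move=> z; rewrite mulr_ge0.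
- exact: intbleZ.
- exact: intble_risk.
have push (g : coords R (model_index n d) -> R) : measurable_fun setT g -> (forall z, 0 <= g z) ->
    (\int[mu]_z (g z)%:E = \int[P]_w1 \int[P]_w2 (g (coordinates A W f (w1, w2)))%:E)%E.
  move=> mg' g0.
  transitivity (\int[(P \x P)%E]_w (g (coordinates A W f w))%:E)%E.
    rewrite [LHS](@ge0_integral_pushforward _ _ _ _ _ _ mc)//; first exact/measurable_EFinP.
    by move=> z _; rewrite lee_fin.
  have mgc : measurable_fun setT (fun w => (g (coordinates A W f w))%:E).
    by apply/measurable_EFinP; exact: (measurableT_comp mg' mc).
  by rewrite (fubini_tonelli1 (m1 := P) (m2 := P) _ mgc)// => w; rewrite lee_fin.
rewrite !push//; last by move=> z; rewrite mulr_ge0.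
apply: ge0_le_integral_all => w1; first by apply: integral_ge0 => w2 _; rewrite lee_fin.
case: (boolP (good (coordinates A W f (w1, point)))) => gw; last first.
  apply: ge0_le_integral_all => w2; first by rewrite lee_fin.
  rewrite lee_fin /on_good /good prior_coordinates -/(good (coordinates A W f (w1, point))).
  by rewrite (negbTE gw) mulr0.
pose Z := prior (coordinates A W f (w1, point)).
have hZ : SOn Z by exact: good_SOn.
apply: (@le_trans _ _ (risk A W sigma Zh Z)).
  rewrite /risk unlock; apply: ge0_le_integral_all => w2; rewrite lee_fin//.
  rewrite /on_good /good prior_coordinates -/(good (coordinates A W f (w1, point))) gw.
  rewrite /r /estimate prior_coordinates -/Z sample_coordinates.
  by apply: misalignment_le_loss => //; exact: hZh.1.
apply: (le_trans (Hrho Z hZ)).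
under eq_integral => w2 _ do rewrite /good prior_coordinates
  -/(good (coordinates A W f (w1, point))) gw mulr1.
rewrite integral_cst// [X in (_ * X)%E](_ : _ = 1%E) ?mule1//.
exact: probability_setT.
Qed.

End bayes.

(** The constant [C1 + 2] dominates both [dr - 1], which pays for replacing [eta + (dr - 1)] by
    [eta], and the 2 of [2 / nr]. *)
Lemma minimax_arithmetic (R : realType) (C1 nr dr eta rho : R) :
  0 < nr -> 0 < eta -> 2 <= dr -> dr <= C1 -> 0 <= rho ->
  dr * (dr - 1) / 2 * (1 - 2 / nr) <= (eta + (dr - 1)) * rho ->
  (1 - (C1 + 2) * (nr^-1 + eta^-1)) * (dr * (dr - 1) / 2 * eta^-1) <= rho.
Proof.
move=> n0 e0 d2 dC r0 H.
have ed : 0 < eta + (dr - 1) by lra.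
rewrite -(ler_pM2l ed); apply: le_trans H.
set m := dr * (dr - 1) / 2.
have m0 : 0 <= m by rewrite /m; nra.
have ni0 : 0 < nr^-1 by rewrite invr_gt0.
have ei0 : 0 < eta^-1 by rewrite invr_gt0.
set a := nr^-1 in ni0 *; set b := eta^-1 in ei0 *.
have eb : eta * b = 1 by rewrite /b divff// gt_eqF.
have -> : (eta + (dr - 1)) * ((1 - (C1 + 2) * (a + b)) * (m * b)) =
    m * ((1 - (C1 + 2) * (a + b)) * (eta * b + (dr - 1) * b)) by ring.
apply: ler_wpM2l => //; rewrite eb.
have h1 : 0 <= (dr - 1) * b by nra.
have h2 : (1 - (C1 + 2) * (a + b)) * ((dr - 1) * b) <= (dr - 1) * b.
  by rewrite ler_piMl//; nra.
have h3 : (dr - 1) * b <= (C1 + 2) * b by rewrite ler_pM2r//; lra.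
have h4 : 2 * a <= (C1 + 2) * a by rewrite ler_pM2r//; lra.
by lra.
Qed.

Theorem theorem3p2 (R : realType) (C1 : R) (hC1 : 2 <= C1) :
  exists c C : R, 0 < c /\ 0 < C /\
  forall (n d : nat) (p sigma : R)
    (disp : measure_display) (Omega : measurableType disp)
    (P : probability Omega R)
    (A : edge n -> {RV P >-> bool})
    (W : edge n -> 'I_d -> 'I_d -> {RV P >-> R}),
  (2 <= n)%N -> 0 < p <= 1 -> 0 < sigma ->
  sync_noise A W p ->
  c <= n%:R * p / sigma ^+ 2 ->
  (2 <= d)%N -> d%:R <= C1 ->
  (((1 - C * (n%:R^-1 + sigma ^+ 2 / (n%:R * p))) *
    (sigma ^+ 2 * d%:R * (d%:R - 1) / (2 * n%:R * p)))%:E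
   <= minimax_risk A W sigma)%E.
Proof.
exists 1, (C1 + 2); split=> //; split; first by lra.
move=> n d p sigma disp Omega P A W n2 p01 sigma0 noise _ d2 dC.
have n0 : (0 < n)%N by exact: leq_trans n2.
have [p0 p1] := andP p01.
have nR : 0 < n%:R :> R by rewrite ltr0n.
have dR : 2 <= d%:R :> R by rewrite (ler_nat _ 2).
pose eta : R := n%:R * p / sigma ^+ 2.
have eta0 : 0 < eta by rewrite divr_gt0 ?mulr_gt0 ?exprn_gt0.
have etaV : sigma ^+ 2 / (n%:R * p) = eta^-1 by rewrite /eta invf_div.
have -> : sigma ^+ 2 * d%:R * (d%:R - 1) / (2 * n%:R * p) = d%:R * (d%:R - 1) / 2 * eta^-1.
  by rewrite -etaV; field; rewrite !gt_eqF.
rewrite etaV; apply: le_ereal_inf_tmp => _ [Zh hZh <-].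
set rho := ereal_sup _.
have risk_le Z : SOn Z -> (risk A W sigma Zh Z <= rho)%E.
  by move=> hZ; apply: ereal_sup_ubound; exists Z.
have hId : SOn (fun _ : 'I_n => (1%:M : 'M[R]_d)) by move=> i; exact: SO1.
have rho0 : (0 <= rho)%E := le_trans (risk_ge0 A W sigma n0 hZh hId) (risk_le _ hId).
(* An infinite supremum makes the bound trivial, and [-oo] is excluded by [rho0]. *)
case: rho rho0 risk_le => [rho| |] // rho0 risk_le; last by rewrite leey.
rewrite lee_fin in rho0 *; apply: minimax_arithmetic => //.
(* For [n = 2] there are too few pairs to build the prior, but then [1 - 2 / n] is 0 and
   nonnegativity of the risk suffices. *)
have [n3|n3] := ltnP 2 n; last first.
  have -> : n%:R = 2 :> R by congr (_%:R); apply/eqP; rewrite eqn_leq n3.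
  by rewrite divff// subrr mulr0 mulr_ge0//; lra.
have [f f_inj] := edges_injection n3.
have gp i a b := joint_gaussian_prior noise f_inj i a b.
have gn e a b := joint_gaussian_noise noise f_inj e a b.
have gm := good_mass_gt0 (joint_independent noise f_inj) gp.
rewrite -(ler_pM2r gm); apply: le_trans (prior_risk_bound (joint_independent noise f_inj)
  gp gn (joint_present noise p01 f_inj) p01 sigma0 n0 hZh) _.
rewrite -[leRHS]mulrA ler_pM2l//; last by rewrite -/eta; lra.
exact: bayes_risk_le.
Qed.
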